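(* Let $T=[0,a]\times[0,b]$ ($a,b>0$) be an oriented rectangle with coordinates $x=(x_0,x_1)$ along its axes, compatible with its orientation, so that the origin of $T$ has coordinates $(0,0)$ and the opposite vertex has coordinates $(a,b)$. Let $A\in\Omega^1(T)\otimes\mathfrak g$ be a smooth connection one-form. For $x=(x_0,x_1)\in T$ let $\gamma^-(x)$ and $\gamma^+(x)$ be the paths consisting of straight segments joining successively the points $$\gamma^-(x):\ (0,0)\to(x_0,0)\to(x_0,x_1),\qquad \gamma^+(x):\ (x_0,x_1)\to(x_0,b)\to(0,b)\to(0,0).$$ Then $$\mathrm{Hol}_A(\partial T)-I=-\int_T \mathrm{PT}_A(\gamma^+(x))\,\mathcal F(A)(x)\,\mathrm{PT}_A(\gamma^-(x))\,\mathrm dx .$$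
   Context: $V$ is a finite-dimensional Euclidean vector space, $\mathbb G$ is a closed subgroup of the group of orthogonal endomorphisms of $V$, and $\mathfrak g\subset\mathrm{End}(V)$ is its Lie algebra. $I$ is the identity of $V$. A connection one-form $A=A_0\,\mathrm dx_0+A_1\,\mathrm dx_1$ with values in $\mathfrak g$ defines the covariant derivative $\nabla_A u=\mathrm du+Au$ on $V$-valued functions. Parallel transport $\mathrm{PT}_A(\gamma):V\to V$ along a piecewise smooth curve $\gamma$ from $x$ to $y$ is the linear map sending $u(x)$ to $u(y)$, where $u$ is a $V$-valued field along $\gamma$ satisfying $\nabla_A u(\dot\gamma)=0$, i.e. $\dot u+A(\dot\gamma)u=0$. If $\gamma$ is closed, $\mathrm{PT}_A(\gamma)$ is called the holonomy and denoted $\mathrm{Hol}_A(\gamma)$. Here $\mathrm{Hol}_A(\partial T)$ is the holonomy along the boundary of $T$ based at the origin and traversed according to the orientation: $(0,0)\to(a,0)\to(a,b)\to(0,b)\to(0,0)$. The curvature of $A$ is $\mathcal F(A)=\mathrm dA+\tfrac12[A,A]$; on $T$, $\mathcal F(A)(x)$ in the integral denotes its coefficient with respect to $\mathrm dx_0\wedge\mathrm dx_1$, namely $\partial_0A_1-\partial_1A_0+[A_0,A_1]$, and $\mathrm dx$ is Lebesgue measure $\mathrm dx_0\,\mathrm dx_1$. *)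

(* Defs.v *)
(* V is R^n with its standard inner product, vectors are columns, and End(V) is
   'M[R]_n acting on the left. *)
From HB Require Import structures.
From mathcomp Require Import all_boot all_order all_algebra.
From mathcomp Require Import all_classical all_reals all_analysis.

Set Implicit Arguments.
Unset Strict Implicit.
Unset Printing Implicit Defensive.

Import Order.TTheory GRing.Theory Num.Theory.
Import numFieldNormedType.Exports.

Local Open Scope classical_set_scope.
Local Open Scope ring_scope.

Definition closed_orthogonal_subgroup (R : realType) (n : nat)
    (G : set 'M[R]_n) : Prop :=
  [/\ closed G,
      (forall P, G P -> P^T *m P = 1%:M),
      G 1%:M,
      (forall P Q, G P -> G Q -> G (P *m Q)) &
      (forall P, G P -> G (invmx P))].

Definition expmx (R : realType) (n : nat) (X : 'M[R]_n) : 'M[R]_n :=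
  lim (series (fun k : nat => (k`!%:R : R)^-1 *: X ^+ k) @ \oo).

Definition lie_algebra (R : realType) (n : nat) (G : set 'M[R]_n) :
    set 'M[R]_n :=
  [set X | forall t : R, G (expmx (t *: X))].

Definition dir0 (R : realType) : R * R := (1, 0).
Definition dir1 (R : realType) : R * R := (0, 1).

Definition pd0 (R : realType) (W : normedModType R) (f : R * R -> W) :
    R * R -> W := fun x => 'D_(dir0 R) f x.
Definition pd1 (R : realType) (W : normedModType R) (f : R * R -> W) :
    R * R -> W := fun x => 'D_(dir1 R) f x.

Fixpoint Ck (R : realType) (W : normedModType R) (k : nat) (U : set (R * R))
    (f : R * R -> W) : Prop :=
  (forall x, U x -> {for x, continuous f}) /\
  (if k is k'.+1 then
     [/\ forall x, U x -> derivable f x (dir0 R) /\ derivable f x (dir1 R),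
         Ck k' U (pd0 f) & Ck k' U (pd1 f)]
   else True).

(* A smooth map on a closed set D is one that is smooth on an open
   neighbourhood of D, so its partial derivatives make sense at every point
   of D, boundary included. *)
Definition smooth_on (R : realType) (W : normedModType R) (D : set (R * R))
    (f : R * R -> W) : Prop :=
  exists U : set (R * R), [/\ open U, D `<=` U & forall k, Ck k U f].

Definition rectangle (R : realType) (a b : R) : set (R * R) :=
  [set x | 0 <= x.1 <= a /\ 0 <= x.2 <= b].

Definition one_form (R : realType) (n : nat) (A0 A1 : R * R -> 'M[R]_n)
    (x v : R * R) : 'M[R]_n :=
  v.1 *: A0 x + v.2 *: A1 x.

Definition curvature (R : realType) (n : nat) (A0 A1 : R * R -> 'M[R]_n)
    (x : R * R) : 'M[R]_n :=
  pd0 A1 x - pd1 A0 x + (A0 x *m A1 x - A1 x *m A0 x).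

(* u is a parallel field along gamma on [0, l]: it is continuous and satisfies
   u' + A(gamma') u = 0 away from finitely many parameters, which include the
   corners of gamma. *)
Definition parallel_along (R : realType) (n : nat) (A0 A1 : R * R -> 'M[R]_n)
    (gamma : R -> R * R) (l : R) (u : R -> 'cV[R]_n) : Prop :=
  {within `[0, l], continuous u} /\
  exists S : seq R, forall t, 0 < t < l -> t \notin S ->
    [/\ derivable gamma t 1, derivable u t 1 &
        derive1 u t + one_form A0 A1 (gamma t) (derive1 gamma t) *m u t = 0].

(* Both clauses are needed: the first makes P unique, the second makes it the
   transport of every parallel field. *)
Definition is_parallel_transport (R : realType) (n : nat)
    (A0 A1 : R * R -> 'M[R]_n) (gamma : R -> R * R) (l : R)
    (P : 'M[R]_n) : Prop :=
  (forall v, exists2 u, parallel_along A0 A1 gamma l u & u 0 = v) /\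
  (forall u, parallel_along A0 A1 gamma l u -> u l = P *m u 0).

Definition PT (R : realType) (n : nat) (A0 A1 : R * R -> 'M[R]_n)
    (gamma : R -> R * R) (l : R) : 'M[R]_n :=
  get [set P | is_parallel_transport A0 A1 gamma l P].

(* The polygonal path p -> s_0 -> s_1 -> ..., each segment being run through at
   constant speed in unit time, so that the parameter interval is
   [0, size s]. *)
Fixpoint polyline (R : realType) (p : R * R) (s : seq (R * R)) (t : R) :
    R * R :=
  if s is q :: s' then
    if t <= 1 then p + t *: (q - p) else polyline q s' (t - 1)
  else p.

Definition PT_polyline (R : realType) (n : nat) (A0 A1 : R * R -> 'M[R]_n)
    (p : R * R) (s : seq (R * R)) : 'M[R]_n :=
  PT A0 A1 (polyline p s) (size s)%:R.

Definition PT_minus (R : realType) (n : nat) (A0 A1 : R * R -> 'M[R]_n)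
    (x : R * R) : 'M[R]_n :=
  PT_polyline A0 A1 (0, 0) [:: (x.1, 0); (x.1, x.2)].

Definition PT_plus (R : realType) (n : nat) (A0 A1 : R * R -> 'M[R]_n) (b : R)
    (x : R * R) : 'M[R]_n :=
  PT_polyline A0 A1 (x.1, x.2) [:: (x.1, b); (0, b); (0, 0)].

Definition Hol_rectangle (R : realType) (n : nat) (A0 A1 : R * R -> 'M[R]_n)
    (a b : R) : 'M[R]_n :=
  PT_polyline A0 A1 (0, 0) [:: (a, 0); (a, b); (0, b); (0, 0)].

Definition lebesgue2 (R : realType) :=
  (@lebesgue_measure R \x @lebesgue_measure R)%E.

Definition mx_integral (R : realType) (m n : nat) (D : set (R * R))
    (F : R * R -> 'M[R]_(m, n)) : 'M[R]_(m, n) :=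
  \matrix_(i, j) (\int[@lebesgue2 R]_(x in D) (F x i j)).

(* Main.v *)
(* Let P be the propagator of A0 along the bottom side, S that of A0 along the
   top side, and Q(x0,.) that of A1 along the vertical line through (x0,0).
   The holonomy of [0,x0] x [0,b] is
     Phi(x0) = Q(0,b)^-1 S(x0)^-1 Q(x0,b) P(x0),
   so that Phi(0) = I and Phi(a) is the holonomy of the whole rectangle.
   Duhamel's formula gives the derivative of Q(x0,b) in x0, and
     d/dx1 (Q^-1 A0 Q) = Q^-1 (d_1 A0 + [A1,A0]) Q
   turns the boundary terms of Phi' into the integral of Q^-1 F(A) Q over
   [0,b]; integrating Phi' over [0,a] and applying Fubini gives the formula.
   To avoid one-sided derivatives at the boundary, A0 and A1 are composed with
   the projection of the plane onto the rectangle, so that the propagators are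
   defined on whole lines. *)
Require Import Defs.
From mathcomp Require Import all_boot all_order all_algebra.
From mathcomp Require Import all_classical all_reals all_analysis.
From mathcomp Require Import measurable_realfun ring lra.
Import Order.TTheory GRing.Theory Num.Theory.
Import numFieldNormedType.Exports.
Local Open Scope classical_set_scope.
Local Open Scope ring_scope.

Set Implicit Arguments.
Unset Strict Implicit.
Unset Printing Implicit Defensive.

(** * Calculus of matrix-valued functions *)

Section matrix_calculus.
Context {R : realType}.

(** [PT] is a [get], so nothing can be computed from it until an explicit matrix is shown to satisfy
    both clauses of [is_parallel_transport]. Propagators supply it: a solution [X] of X' = -BX on
    the whole line gives a parallel field for each initial value, and its inverse [Y], which solves
    Y' = YB, makes Y u constant for each parallel u. All transports of the statement become products
    of propagators, and the integrand at (x0,x1) factors as M(x0) (Q^-1 F(A) Q)(x0,x1) P(x0) with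
    M(x0) = Q(0,b)^-1 S(x0)^-1 Q(x0,b); only the middle factor depends on x1. The obstacle is
    regularity. The projected forms are continuous and bounded but need not be differentiable across
    the boundary of the rectangle, and the vertical propagators are chosen separately for each x0.
    Hence the joint continuity of Q comes from a comparison of two propagators, derivatives in x0
    are taken at interior points only, and the closed interval is reached by continuity. *)

Lemma mx_norm_le m n (M : 'M[R]_(m, n)) c :
  0 <= c -> (forall i j, `|M i j| <= c) -> `|M| <= c.
Proof.
move=> c0 Mc; rewrite /Num.Def.normr/= mx_normrE.
by apply: bigmax_le => // -[i j] _ /=.
Qed.

Lemma mx_norm_ge m n (M : 'M[R]_(m, n)) i j : `|M i j| <= `|M|.
Proof.
rewrite [leRHS]/Num.Def.normr/= mx_normrE.
exact: (le_bigmax _ (fun ij : 'I_m * 'I_n => `|M ij.1 ij.2|) (i, j)).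
Qed.

(** The norm is the largest absolute entry, which is not submultiplicative in general; an entry of
    the product has [n] terms, hence the factor [n%:R] that recurs in the later constants. *)
Lemma mx_norm_mul m n p (M : 'M[R]_(m, n)) (N : 'M[R]_(n, p)) :
  `|M *m N| <= n%:R * (`|M| * `|N|).
Proof.
apply: mx_norm_le => [|i j]; first by rewrite !mulr_ge0.
rewrite mxE (le_trans (ler_norm_sum _ _ _))//.
apply: (@le_trans _ _ (\sum_(k < n) (`|M| * `|N|))).
  by apply: ler_sum => k _; rewrite normrM ler_pM// mx_norm_ge.
by rewrite sumr_const card_ord mulr_natl.
Qed.

Lemma mx_norm1 n : `|1%:M : 'M[R]_n| <= 1.
Proof.
apply: mx_norm_le => // i j; rewrite mxE.
by case: eqP => _; rewrite ?normr1 ?normr0.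
Qed.

Lemma mx_norm_tr m n (M : 'M[R]_(m, n)) : `|M^T| = `|M|.
Proof.
apply/eqP; rewrite eq_le !mx_norm_le// => i j; rewrite ?mxE ?mx_norm_ge//.
by have := mx_norm_ge M^T j i; rewrite mxE.
Qed.

Lemma cvg_mxP {T : Type} {F : set_system T} {FF : Filter F} m n
    (f : T -> 'M[R]_(m, n)) (M : 'M[R]_(m, n)) :
  f @ F --> M <-> forall i j, f x i j @[x --> F] --> M i j.
Proof.
split=> [fM i j|fM]; apply/cvgrPdist_le => e e0.
  near=> x; have := mx_norm_ge (M - f x) i j; rewrite !mxE => /le_trans; apply.
  by near: x; move/cvgrPdist_le: fM; apply.
have fM' : \forall x \near F, forall i j, `|M i j - f x i j| <= e.
  apply: filter_forall => i; apply: filter_forall => j.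
  by move/cvgrPdist_le: (fM i j); apply.
near=> x; apply: mx_norm_le; first exact: ltW.
by move=> i j; rewrite !mxE; move: i j; near: x.
Unshelve. all: by end_near. Qed.

Lemma cvg_mulmx {T : Type} {F : set_system T} {FF : Filter F} m n p
    (f : T -> 'M[R]_(m, n)) (g : T -> 'M[R]_(n, p))
    (M : 'M[R]_(m, n)) (N : 'M[R]_(n, p)) :
  f @ F --> M -> g @ F --> N -> (f x *m g x) @[x --> F] --> M *m N.
Proof.
move=> /cvg_mxP fM /cvg_mxP gN; apply/cvg_mxP => i j.
under eq_fun do rewrite mxE; rewrite mxE.
apply: cvg_big => [|k _]; first exact: add_continuous.
by apply: cvgM; [exact: fM|exact: gN].
Qed.

Lemma is_derive_mxP (V : normedModType R) m n (f : V -> 'M[R]_(m, n)) x v D :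
  is_derive x v f D <-> forall i j, is_derive x v (fun y => f y i j) (D i j).
Proof.
split=> [[fd <-] i j|fD].
  have /derivable_mxP fd' := fd.
  by rewrite derive_mx// mxE; exact: derivableP.
have fd : derivable f x v by apply/derivable_mxP => i j; case: (fD i j).
by apply: DeriveDef => //; rewrite derive_mx//; apply/matrixP => i j;
  rewrite mxE derive_val.
Qed.

Lemma is_derive_mulmx (V : normedModType R) m n p (f : V -> 'M[R]_(m, n))
    (g : V -> 'M[R]_(n, p)) x v df dg :
  is_derive x v f df -> is_derive x v g dg ->
  is_derive x v (fun y => f y *m g y) (df *m g x + f x *m dg).
Proof.
move=> /is_derive_mxP fd /is_derive_mxP gd; apply/is_derive_mxP => i j.
rewrite (_ : (fun y => _) =
  (\sum_(k < n) ((fun y => f y i k) * (fun y => g y k j)))%R); last first.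
  by apply/funext => y; rewrite mxE fct_sumE.
have -> : (df *m g x + f x *m dg) i j =
    \sum_(k < n) (f x i k *: dg k j + g x k j *: df i k).
  by rewrite !mxE -big_split/=; apply: eq_bigr => k _;
    rewrite addrC [in RHS]/GRing.scale/= [X in _ = _ + X]mulrC.
apply: is_derive_sum => k.
have fk := fd i k; have gk := gd k j; exact: is_deriveM.
Qed.

Lemma is_derive_continuous (V : normedModType R) (f : R -> V) (x : R) (D : V) :
  is_derive x 1 f D -> {for x, continuous f}.
Proof. by case=> /derivable1_diffP/differentiable_continuous. Qed.

(** Mean value inequality with a majorant [g]. Each entry is handled by the scalar mean value
    theorem for g - s f, where s = 1 and s = -1 bound both signs. *)
Lemma ler_dist_derive m n (f df : R -> 'M[R]_(m, n)) (g dg : R -> R) a b :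
  a <= b -> {within `[a, b], continuous f} -> {within `[a, b], continuous g} ->
  (forall x, a < x < b -> is_derive x 1 f (df x)) ->
  (forall x, a < x < b -> is_derive x 1 g (dg x)) ->
  (forall x, a < x < b -> `|df x| <= dg x) ->
  `|f b - f a| <= g b - g a.
Proof.
move=> ab cf cg fd gd fg.
have [ltab|gea] := ltP a b; last first.
  have -> : b = a by apply/eqP; rewrite eq_le gea.
  by rewrite !subrr normr0.
have key (s : R) i j : `|s| = 1 -> s * (f b i j - f a i j) <= g b - g a.
  move=> s1.
  pose h x := g x - s * f x i j.
  have hd x : x \in `]a, b[%R -> is_derive x 1 h (dg x - s * df x i j).
    rewrite in_itv/= => xab; rewrite /h.
    have /is_derive_mxP /(_ i j) fij := fd _ xab.
    have gx := gd _ xab.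
    by apply: is_deriveB; exact: is_deriveZ.
  have ch : {within `[a, b], continuous h}.
    move=> x; apply: cvgB; first exact: cg.
    by apply: cvgMr; have /cvg_mxP := cf x; exact.
  have [c cab] := MVT ltab hd ch.
  have : 0 <= (dg c - s * df c i j) * (b - a).
    rewrite mulr_ge0 ?subr_ge0//; move: cab; rewrite in_itv/= => /fg.
    apply: le_trans; apply: le_trans (mx_norm_ge _ i j).
    by apply: le_trans (ler_norm _) _; rewrite normrM s1 mul1r.
  rewrite /h => + H; rewrite -H; lra.
apply: mx_norm_le => [|i j]; rewrite ?mxE.
  have : forall x, x \in `]a, b[%R -> is_derive x 1 g (dg x).
    by move=> x; rewrite in_itv/=; exact: gd.
  move=> /(MVT ltab)/(_ cg)[c cab ->]; rewrite mulr_ge0 ?subr_ge0//.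
  by move: cab; rewrite in_itv/= => /fg; exact: le_trans.
rewrite ler_norml; apply/andP; split; last first.
  by have := key 1 i j; rewrite normr1 mul1r; apply.
have := key (-1) i j; rewrite normrN1 => /(_ erefl); lra.
Qed.

(** The finite set [S] matches the exceptional parameters allowed by [parallel_along]; splitting the
    interval at such a point, continuity carries constancy across it. *)
Lemma derive0_cst m n (f : R -> 'M[R]_(m, n)) (S : seq R) a b :
  a <= b -> {within `[a, b], continuous f} ->
  (forall x, a < x < b -> x \notin S -> is_derive x 1 f 0) -> f b = f a.
Proof.
elim: S a b => [|p S IH] a b ab cf fd.
  apply/eqP; rewrite -subr_eq0 -normr_le0.
  rewrite -[leRHS](subrr (0 : R)).
  apply: (@ler_dist_derive _ _ f (fun=> 0) (fun=> 0) (fun=> 0)) => //.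
  - by move=> x; exact: cvg_cst.
  - by move=> x /fd; exact.
  - by move=> x _; rewrite normr0.
have [/andP[ap pb]|pab] := boolP (a < p < b); last first.
  apply: IH => // x xab xS; apply: fd => //; rewrite inE negb_or xS andbT.
  by apply: contraNneq pab => <-.
have -> : f b = f p.
  apply: IH => [||x /andP[px xb] xS]; first exact: ltW.
    by apply: continuous_subspaceW cf; apply: subset_itvr; rewrite bnd_simp ltW.
  apply: fd; first by rewrite xb (lt_trans ap).
  by rewrite inE negb_or xS gt_eqF.
apply: IH => [||x /andP[ax xp] xS]; first exact: ltW.
  by apply: continuous_subspaceW cf; apply: subset_itvl; rewrite bnd_simp ltW.
apply: fd; first by rewrite ax (lt_trans xp).
by rewrite inE negb_or xS lt_eqF.
Qed.

Lemma primitive_exists_R (f : R -> R) : continuous f ->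
  exists F : R -> R, F 0 = 0 /\ forall t : R, is_derive t 1 F (f t).
Proof.
move=> cf; pose mu := @lebesgue_measure R.
have fi (a b : R) : mu.-integrable `[a, b] (EFin \o f).
  apply: continuous_compact_integrable; first exact: segment_compact.
  exact: continuous_subspaceT.
pose G (a x : R) : R := \int[mu]_(t in `[a, x]) f t.
have Gd (a x : R) : a < x -> is_derive x 1 (G a) (f x).
  move=> ax.
  have [] := @continuous_FTC1_closed R f a x (x + 1) _ (fi _ _) ax (cf x).
    by rewrite ltrDl.
  by rewrite derive1E => ? <-; exact: derivableP.
have GD (a a' x : R) : a' <= a -> a < x -> G a' x = G a' a + G a x.
  move=> a'a ax; apply/eqP; rewrite addrC -subr_eq; apply/eqP.
  rewrite /G Rintegral_itvB ?bnd_simp//; last exact: ltW.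
  rewrite Rintegral_itv_obnd_cbnd//.
  by apply: integrableS (fi a x) => //; exact: subset_itv_oc_cc.
(* The lower bound lies strictly below both 0 and [t], so that [Gd] also reaches negative
   parameters; by [FE], moving it further left does not change [F]. *)
pose F t : R := G (- (`|t| + 1)) t - G (- (`|t| + 1)) 0.
have FE (t c : R) : `|t| + 1 <= c -> F t = G (- c) t - G (- c) 0.
  move=> tc; have ct : - c <= - (`|t| + 1) by rewrite lerN2.
  have := ler_norm (- t); rewrite normrN => tn; have := normr_ge0 t => t0.
  rewrite (GD _ _ t ct) ?(GD _ _ 0 ct) /F; lra.
exists F; split; first by rewrite /F subrr.
move=> t.
(* The lower bound -(|t| + 2) serves all [s] with |s - t| <= 1 at once. *)
apply: (@near_eq_is_derive _ _ _
  (fun s => G (- (`|t| + 2)) s - G (- (`|t| + 2)) 0)).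
  near=> s; apply/esym/FE.
  have : `|s - t| <= 1 by rewrite distrC; near: s; exact: cvgr_dist_le.
  have := ler_normD (s - t) t; rewrite subrK; lra.
rewrite -[f t]subr0; apply: is_deriveB; apply: Gd.
by have := ler_norm (- t); rewrite normrN; lra.
Unshelve. all: by end_near. Qed.

Lemma primitive_exists m n (f : R -> 'M[R]_(m, n)) : continuous f ->
  exists F : R -> 'M[R]_(m, n), F 0 = 0 /\ forall t : R, is_derive t 1 F (f t).
Proof.
move=> cf.
have cfij i j : continuous (fun t => f t i j).
  by move=> t; have /cvg_mxP := cf t; exact.
pose F t := \matrix_(i, j) sval (cid (primitive_exists_R (cfij i j))) t.
exists F; split.
  apply/matrixP => i j; rewrite !mxE.
  by case: (svalP (cid (primitive_exists_R (cfij i j)))).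
move=> t; apply/is_derive_mxP => i j.
rewrite (_ : (fun y => _) = sval (cid (primitive_exists_R (cfij i j)))).
  by case: (svalP (cid (primitive_exists_R (cfij i j)))).
by apply/funext => y; rewrite mxE.
Qed.

End matrix_calculus.

(** * Linear differential equations *)

Section linear_ode.
Context {R : realType}.

Lemma is_derive_within_continuous (V : normedModType R) (f df : R -> V) a b :
  (forall t : R, is_derive t 1 f (df t)) -> {within `[a, b], continuous f}.
Proof.
by move=> fd; apply: continuous_subspaceT => t; apply: is_derive_continuous.
Qed.

Lemma is_derive_affine (V : normedModType R) (f : R -> V) (c d t : R) (D : V) :
  is_derive (c * t + d) 1 f D ->
  is_derive t 1 (fun s => f (c * s + d)) (c *: D).
Proof.
move=> [/derivable1_diffP fd fD].
have cd : is_derive t 1 (fun s => c * s + d) c.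
  have h1 : is_derive t 1 (c *: (@id R)) (c *: (1 : R)) by exact: is_deriveZ.
  have h2 : is_derive t 1 (@cst R R d) (0 : R) by exact: is_derive_cst.
  have := is_deriveD h1 h2; rewrite addr0 [c *: 1]mulr1.
  exact.
have od : differentiable (fun s => c * s + d) t by case: cd => /derivable1_diffP.
have fod : differentiable (f \o (fun s => c * s + d)) t.
  exact: differentiable_comp.
apply: DeriveDef. exact/derivable1_diffP.
rewrite deriveE//. 
rewrite diff_comp//=. rewrite  -(deriveE _ od) derive_val -fD.
rewrite deriveE//.
rewrite -[X in 'd _ _ X = _]mulr1. by rewrite [LHS]linearZ.
Qed.

Lemma is_derive_mull (c t : R) : is_derive t 1 (fun s => c * s) c.
Proof.
have h : is_derive t 1 (c *: @id R) (c *: (1 : R)) by exact: is_deriveZ.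
by rewrite -[X in is_derive _ _ _ X](mulr1 c).
Qed.

(* [expR (l * `|t|)] is the weight for which a primitive vanishing at [0] is
   [l^-1] times smaller than its derivative. *)
Lemma ler_primitive_expR m n (F f : R -> 'M[R]_(m, n)) (l K : R) :
  0 <= K -> F 0 = 0 -> (forall t : R, is_derive t 1 F (f t)) ->
  (forall t, `|f t| <= K * (l * expR (l * `|t|))) ->
  forall t, `|F t| <= K * expR (l * `|t|).
Proof.
move=> K0.
have pos (G g : R -> 'M[R]_(m, n)) t : 0 <= t -> G 0 = 0 ->
    (forall t : R, is_derive t 1 G (g t)) ->
    (forall t, `|g t| <= K * (l * expR (l * `|t|))) ->
    `|G t| <= K * expR (l * `|t|).
  move=> t0 G0 Gd gK.
  have gd (s : R) : is_derive s 1 (fun s => K * expR (l * s))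
      (K * (l * expR (l * s))).
    have := @is_derive_affine _ expR l 0 s (expR (l * s)).
    rewrite addr0 => /(_ (is_derive_expR _)).
    by under eq_fun do rewrite addr0; move=> ?; exact: is_deriveZ.
  have := @ler_dist_derive R m n G g (fun s => K * expR (l * s))
    (fun s => K * (l * expR (l * s))) 0 t t0
    (is_derive_within_continuous Gd) (is_derive_within_continuous gd)
    (fun x _ => Gd x) (fun x _ => gd x).
  rewrite G0 subr0 mulr0 expR0 mulr1 (ger0_norm t0) => H.
  apply: le_trans (H _) _; last by rewrite gerBl.
  by move=> x /andP[x0 _]; rewrite -{2}(gtr0_norm x0).
move=> F0 Fd fK t; have [t0|/ltW t0] := leP 0 t; first exact: (pos F f).
have := pos (fun s => F (- s)) (fun s => - f (- s)) (- t).
rewrite opprK normrN oppr0; apply => //; first by rewrite oppr_ge0.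
  move=> s; have := @is_derive_affine _ F (-1) 0 s (f (- s)).
  rewrite mulN1r addr0 scaleN1r => /(_ (Fd _)).
  by under eq_fun do rewrite mulN1r addr0.
by move=> s; rewrite normrN -(normrN s).
Qed.

Lemma cvg_geometric_half : (2^-1 : R) ^+ k @[k --> \oo] --> (0 : R).
Proof. by apply: cvg_expr; rewrite ger0_norm// invf_lt1// ltr1n. Qed.

Lemma cauchy_bound m n (u : nat -> 'M[R]_(m, n)) (c : nat -> R) :
  c k @[k --> \oo] --> (0 : R) ->
  (forall k p, `|u (k + p)%N - u k| <= c k) ->
  exists l, forall k, `|l - u k| <= c k.
Proof.
move=> c0 uc.
have uC : cvg (u k @[k --> \oo]).
  apply/cauchy_cvgP/cauchy_exP => e e0.
  have [N _ /(_ N (leqnn N))/= cN] : \forall k \near \oo, c k < e.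
    by apply: (cvgr_lt (0 : R)).
  exists (u N); exists N => // k /= Nk.
  rewrite -ball_normE/= distrC (le_lt_trans _ cN)//.
  by rewrite -(subnKC Nk).
exists (lim (u k @[k --> \oo])) => k.
have ul : `|u p - u k| @[p --> \oo] --> `|lim (u k @[k --> \oo]) - u k|.
  by apply: cvg_norm; apply: cvgB => //; exact: cvg_cst.
rewrite -(cvg_lim _ ul)//.
apply: limr_le; first by apply/cvg_ex; eexists; exact: ul.
by near=> p; rewrite -(@subnKC k p)//; near: p; exists k.
Unshelve. all: by end_near. Qed.

(** The primitive of B X vanishing at 0 is picked by [get], hence under control only when one
    exists, as for continuous [B] and [X]. *)
Definition picard_step n (B X : R -> 'M[R]_n) : R -> 'M[R]_n :=
  fun t => 1%:M +
    get [set F : R -> 'M[R]_n |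
      F 0 = 0 /\ forall t : R, is_derive t 1 F (B t *m X t)] t.

Lemma picard_stepP n (B X : R -> 'M[R]_n) :
  continuous B -> continuous X ->
  picard_step B X 0 = 1%:M /\
  forall t : R, is_derive t 1 (picard_step B X) (B t *m X t).
Proof.
move=> cB cX; rewrite /picard_step.
have cBX : continuous (fun t => B t *m X t).
  by move=> t; apply: cvg_mulmx; [exact: cB|exact: cX].
have [F F_prim] := primitive_exists cBX.
have := @getI _ [set F : R -> 'M[R]_n |
  F 0 = 0 /\ forall t : R, is_derive t 1 F (B t *m X t)] F F_prim.
move: (get _) => G /= [G0 Gd]; split=> [|t]; first by rewrite G0 addr0.
by rewrite -[B t *m X t]add0r; exact: is_deriveD.
Qed.

(** Picard iteration in the sup norm with weight exp(-l|t|): since l >= 2nC, one step halves the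
    weighted distance on the whole line, so the solution is global at once. The final bound adds |S
    0| <= 1 to the distance, at most 2 exp(l|t|), from [S 0] to the limit. It depends on [B] only
    through [C], which later makes it uniform in a parameter. *)
Lemma linear_ode_exists n (B : R -> 'M[R]_n) C :
  continuous B -> (forall t, `|B t| <= C) ->
  exists X : R -> 'M[R]_n,
    [/\ X 0 = 1%:M,
        forall t : R, is_derive t 1 X (B t *m X t) &
        forall t, `|X t| <= 1 + 2 * expR ((2 * (n%:R * C) + 1) * `|t|)].
Proof.
move=> cB BC; set l := 2 * _ + 1; set E := fun t : R => expR (l * `|t|).
have nC0 : 0 <= n%:R * C.
  by rewrite mulr_ge0// (le_trans _ (BC 0)).
have E1 t : 1 <= E t.
  by rewrite -expR0 ler_expR mulr_ge0// /l; lra.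
pose h k : R := 2^-1 ^+ k.
have h0 k : 0 <= h k by rewrite exprn_ge0.
have hS k : h k = 2 * h k.+1 by rewrite /h exprS mulrA divff ?mul1r.
pose S k := iter k (picard_step B) (fun=> 1%:M).
have cS k : continuous (S k).
  elim: k => [|k IH] t; first exact: cvg_cst.
  by apply: is_derive_continuous; have [_] := picard_stepP cB IH; exact.
have step (X Y : R -> 'M[R]_n) k c : 0 <= c -> continuous X -> continuous Y ->
    (forall t, `|X t - Y t| <= h k * c * E t) ->
    forall t, `|picard_step B X t - picard_step B Y t| <= h k.+1 * c * E t.
  move=> c0 cX cY XY.
  have [X0 Xd] := picard_stepP cB cX; have [Y0 Yd] := picard_stepP cB cY.
  apply: (@ler_primitive_expR _ _ _ (fun t => B t *m (X t - Y t))) => //.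
  - by rewrite mulr_ge0.
  - by rewrite X0 Y0 subrr.
  - by move=> t; rewrite mulmxBr; exact: is_deriveB.
  - move=> t; apply: le_trans (mx_norm_mul _ _) _.
    have := XY t; rewrite hS => XYt.
    apply: (@le_trans _ _ (n%:R * (C * (2 * h k.+1 * c * E t)))).
      by rewrite ler_wpM2l// ler_pM.
    rewrite -/(E t) /l.
    have hc : 0 <= h k.+1 * c * E t by rewrite !mulr_ge0// expR_ge0.
    have := mulr_ge0 nC0 hc; nra.
have SS k t : `|S k.+1 t - S k t| <= h k * E t.
  elim: k t => [t|k IH t]; last first.
    have := step (S k.+1) (S k) k 1 ler01 (cS _) (cS _); rewrite !mulr1.
    exact.
  have [X0 Xd] := picard_stepP cB (cS 0).
  rewrite /h expr0.
  apply: (@ler_primitive_expR _ _ (fun t => S 1 t - S 0 t) B) => //.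
  - by rewrite [S 1%N 0]X0 subrr.
  - move=> s; rewrite -[B s]subr0; apply: is_deriveB.
    by rewrite -[B s]mulmx1; exact: Xd.
  - move=> s; rewrite mul1r -/(E s) -[B s]mulmx1.
    apply: le_trans (mx_norm_mul _ _) _.
    apply: (@le_trans _ _ (n%:R * (C * 1))).
      by rewrite ler_wpM2l// ler_pM// mx_norm1.
    rewrite mulr1; apply: (@le_trans _ _ l); first by rewrite /l; lra.
    by rewrite ler_peMr// /l; lra.
have SSp k p t : `|S (k + p)%N t - S k t| <= h k * 2 * E t.
  (* The exact value of the geometric sum is kept, so that the induction on [p] closes. *)
  apply: (@le_trans _ _ ((h k * 2 - h (k + p)%N * 2) * E t)); last first.
    have := E1 t; have := h0 (k + p)%N; nra.
  elim: p => [|p IH]; first by rewrite addn0 !subrr normr0 mul0r.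
  rewrite addnS -(subrKA (S (k + p)%N t)) (le_trans (ler_normD _ _))//.
  by have := SS (k + p)%N t; have := hS (k + p)%N; nra.
have SX t : exists x, forall k, `|x - S k t| <= h k * 2 * E t.
  apply: (@cauchy_bound _ _ (fun k => S k t)) => //.
  rewrite -(mul0r (2 * E t)); under eq_fun do rewrite -mulrA.
  by apply: cvgMl; exact: cvg_geometric_half.
have {SX}[X SX] := choice SX.
have cX : continuous X.
  move=> t; apply/cvgrPdist_le => e e0.
  pose L := expR (l * (`|t| + 1)).
  have L0 : 0 < L by exact: expR_gt0.
  have [k hk] : exists k, h k * 2 * L <= e / 4.
    have [k _ /(_ k (leqnn k))/= hk] : \forall k \near \oo, h k < e / 8 / L.
      by apply: (cvgr_lt _ cvg_geometric_half); rewrite !divr_gt0.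
    exists k; move: hk; rewrite ltr_pdivlMr// => hk; lra.
  have SXL s : `|s| <= `|t| + 1 -> `|X s - S k s| <= e / 4.
    move=> st; apply: le_trans (SX s k) _; apply: le_trans hk.
    rewrite ler_wpM2l ?mulr_ge0// ler_expR ler_wpM2l// /l; lra.
  near=> s.
  have st : `|s| <= `|t| + 1.
    have : `|s - t| <= 1 by rewrite distrC; near: s; exact: cvgr_dist_le.
    have := ler_normD (s - t) t; rewrite subrK; lra.
  have Sts : `|S k t - S k s| <= e / 4.
    by near: s; move/cvgrPdist_le: (cS k t); apply; rewrite divr_gt0.
  have -> : X t - X s = (X t - S k t) + (S k t - S k s) - (X s - S k s).
    by rewrite addrA subrK opprB addrA subrK.
  have := ler_normB (X t - S k t + (S k t - S k s)) (X s - S k s).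
  have := ler_normD (X t - S k t) (S k t - S k s).
  have := SXL s st; have := SXL t; lra.
have [X0 Xd] := picard_stepP cB cX.
have XE : picard_step B X = X.
  apply/funext => t; apply/eqP; rewrite -subr_eq0 -normr_le0.
  (* Both [X] and its Picard image are within a multiple of [h k] of [S k.+1], so the limit is a
     fixed point. *)
  have XX k : `|picard_step B X t - X t| <= h k * (2 * E t).
    have := step X (S k) k 2 (ler0n _ _) cX (cS k) (SX^~ k) t.
    rewrite (hS k); have := SX t k.+1; rewrite distrC.
    rewrite -[picard_step B X t - X t](subrKA (S k.+1 t)).
    have := ler_normD (picard_step B X t - S k.+1 t) (S k.+1 t - X t).
    by rewrite -/(S k.+1); lra.
  have h0' : h k * (2 * E t) @[k --> \oo] --> 0 * (2 * E t).
    by apply: cvgMl; exact: cvg_geometric_half.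
  rewrite -(mul0r (2 * E t)) -(cvg_lim _ h0')//.
  apply: limr_ge; first by apply/cvg_ex; eexists; exact: h0'.
  by near=> k.
rewrite XE in X0 Xd; exists X; split => // t.
have := SX t 0%N; rewrite /h expr0 mul1r => Xt1.
by rewrite -(subrK 1%:M (X t)) addrC (le_trans (ler_normD _ _))// lerD// mx_norm1.
Unshelve. all: by end_near. Qed.

End linear_ode.

(** * Propagators of a linear equation and their joint continuity in a parameter *)

Section propagators.
Context {R : realType}.

(** The sign is that of u' + B u = 0. The inverse [Y] is carried with its own equation, so that no
    inverse has to be differentiated. *)
Definition propagator n (B X Y : R -> 'M[R]_n) : Prop :=
  [/\ X 0 = 1%:M, Y 0 = 1%:M, (forall t, X t *m Y t = 1%:M),
      (forall t : R, is_derive t 1 X (- (B t *m X t))) &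
      (forall t : R, is_derive t 1 Y (Y t *m B t))].

Lemma is_derive_trmx (V : normedModType R) m n (f : V -> 'M[R]_(m, n)) x v D :
  is_derive x v f D -> is_derive x v (fun y => (f y)^T) D^T.
Proof.
move=> /is_derive_mxP fd; apply/is_derive_mxP => i j; rewrite mxE.
by under eq_fun do rewrite mxE.
Qed.

Lemma derive0_cstT m n (f : R -> 'M[R]_(m, n)) :
  (forall t : R, is_derive t 1 f 0) -> forall t, f t = f 0.
Proof.
move=> fd t; have [t0|/ltW t0] := leP 0 t.
  exact: (derive0_cst (S := [::]) t0 (is_derive_within_continuous fd)).
apply/esym.
exact: (derive0_cst (S := [::]) t0 (is_derive_within_continuous fd)).
Qed.

(** The inverse is the transpose of the solution of Z' = B^T Z: then Y' = Y B, and Y X has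
    derivative zero. For square matrices a left inverse is also a right inverse. *)
Lemma propagator_exists n (B : R -> 'M[R]_n) C :
  continuous B -> (forall t, `|B t| <= C) ->
  exists X Y : R -> 'M[R]_n, propagator B X Y /\
    forall t, let K := 1 + 2 * expR ((2 * (n%:R * C) + 1) * `|t|) in
      `|X t| <= K /\ `|Y t| <= K.
Proof.
move=> cB BC.
have cNB : continuous (fun t => - B t) by move=> t; apply: cvgN; exact: cB.
have NBC t : `|- B t| <= C by rewrite normrN.
have cBt : continuous (fun t => (B t)^T).
  move=> t; apply/cvg_mxP => i j; under eq_fun do rewrite mxE; rewrite mxE.
  by have /cvg_mxP := cB t; exact.
have BtC t : `|(B t)^T| <= C by rewrite mx_norm_tr.
have [X [X0 Xd XK]] := linear_ode_exists cNB NBC.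
have [Z [Z0 Zd ZK]] := linear_ode_exists cBt BtC.
have Yd (t : R) : is_derive t 1 (fun s => (Z s)^T) ((Z t)^T *m B t).
  by rewrite -[B t]trmxK -trmx_mul; exact: is_derive_trmx.
exists X, (fun t => (Z t)^T); split; last first.
  by move=> t K; rewrite mx_norm_tr; split.
have YX t : (Z t)^T *m X t = 1%:M.
  have -> : 1%:M = (Z 0)^T *m X 0 by rewrite X0 Z0 trmx1 mulmx1.
  apply: (derive0_cstT (f := fun t => (Z t)^T *m X t)) => {t}.
  move=> s; have := is_derive_mulmx (Yd s) (Xd s).
  by rewrite mulNmx mulmxN mulmxA subrr.
split=> [||t|t|] //; first by rewrite Z0 trmx1.
  exact: mulmx1C.
by rewrite -mulNmx.
Qed.

Lemma ler_dist_between m n (f df : R -> 'M[R]_(m, n)) (c x y : R) :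
  (forall r : R, `|r - x| <= `|y - x| -> is_derive r 1 f (df r)) ->
  (forall r, `|r - x| <= `|y - x| -> `|df r| <= c) ->
  `|f y - f x| <= c * `|y - x|.
Proof.
move=> fd fc.
have main (u v : R) : u <= v ->
    (forall r, u <= r <= v -> `|r - x| <= `|y - x|) ->
    `|f v - f u| <= c * (v - u).
  move=> uv near_x; have gd := is_derive_mull c.
  have cf : {within `[u, v], continuous f}.
    apply: continuous_in_subspaceT => r; rewrite inE/= in_itv/= => /near_x rx.
    exact: is_derive_continuous (fd _ rx).
  have uvW r : u < r < v -> `|r - x| <= `|y - x|.
    by move=> /andP[/ltW ur /ltW rv]; apply: near_x; rewrite ur.
  rewrite mulrBr; apply: (ler_dist_derive uv cf
    (is_derive_within_continuous gd) (fun r ruv => fd r (uvW r ruv))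
    (fun r _ => gd r)) => r ruv.
  exact: fc (uvW r ruv).
have [xy|/ltW yx] := leP x y.
  rewrite ger0_norm ?subr_ge0//; apply: main => // r /andP[xr ry].
  by rewrite !ger0_norm ?subr_ge0// lerD2r.
rewrite distrC ler0_norm ?subr_le0// opprB; apply: main => // r /andP[yr rx].
by rewrite !ler0_norm ?subr_le0// lerN2 lerD2r.
Qed.

Lemma ler_dist_lip m n (f df : R -> 'M[R]_(m, n)) c L :
  (forall t : R, is_derive t 1 f (df t)) ->
  (forall t, `|t| <= L -> `|df t| <= c) ->
  forall t, `|t| <= L -> `|f t - f 0| <= c * L.
Proof.
move=> fd fc t tL; have L0 : 0 <= L := le_trans (normr_ge0 t) tL.
have c0 : 0 <= c by rewrite (le_trans _ (fc 0 _)) ?normr0.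
apply: le_trans (ler_dist_between (fun r _ => fd r) (c := c) _) _.
  by move=> r; rewrite !subr0 => rt; apply: fc; exact: le_trans tL.
by rewrite subr0 ler_wpM2l.
Qed.

(* Duhamel: the derivative of [Y *m X'] only involves [B - B']. *)
Lemma propagator_dist n (B B' X X' Y Y' : R -> 'M[R]_n) K L e :
  propagator B X Y -> propagator B' X' Y' ->
  (forall t, `|t| <= L -> `|Y t| <= K /\ `|X' t| <= K) ->
  (forall t, `|t| <= L -> `|B t - B' t| <= e) ->
  forall t, `|t| <= L ->
    `|Y t *m X' t - 1%:M| <= n%:R * (n%:R * (K * e) * K) * L.
Proof.
move=> [X0 Y0 XY Xd Yd] [X'0 Y'0 XY' Xd' Yd'] LK Le t tL.
have Dd (s : R) : is_derive s 1 (fun s => Y s *m X' s)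
    (Y s *m (B s - B' s) *m X' s).
  have := is_derive_mulmx (Yd s) (Xd' s).
  by rewrite mulmxN mulmxA mulmxBr mulmxBl.
have := ler_dist_lip Dd _ tL; rewrite Y0 X'0 mulmx1; apply => s sL.
have [YK X'K] := LK s sL; have BB := Le s sL.
apply: le_trans (mx_norm_mul _ _) _; rewrite ler_wpM2l// ler_pM//.
by apply: le_trans (mx_norm_mul _ _) _; rewrite ler_wpM2l// ler_pM.
Qed.

(** Tube lemma: compactness of [K] makes continuity at the points of the slice over [x0] uniform.
    Two nearby values are both compared with the value at the centre of a neighbourhood, hence e /
    2. *)
Lemma near_uniform (V : normedModType R) (f : R * R -> V) x0 (K : set R) e :
  compact K -> (forall t, K t -> {for (x0, t), continuous f}) -> 0 < e ->
  \forall x \near x0, forall t, K t -> `|f (x, t) - f (x0, t)| <= e.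
Proof.
move=> /compact_near_coveringP cK cf e0.
apply: (cK R (nbhs x0) (fun x t => `|f (x, t) - f (x0, t)| <= e) _) => t Kt.
have e2 : 0 < e / 2 by rewrite divr_gt0.
have [[U V'] /= [Ux0 V't] UV] :
    \forall p \near (x0, t), `|f (x0, t) - f p| <= e / 2.
  by move/cvgrPdist_le: (cf t Kt); apply.
exists (V', U) => //= -[t' x] /= [V't' Ux].
rewrite -(subrKA (f (x0, t))) (le_trans (ler_normD _ _))// [leRHS]splitr.
rewrite lerD//; first by rewrite distrC; apply: (UV (x, t')).
by apply: (UV (x0, t')); split => //=; exact: nbhs_singleton.
Qed.

Lemma continuous_near_uniform (V : normedModType R) (f : R -> R -> V) :
  (forall x, continuous (f x)) ->
  (forall x L e, 0 < e -> \forall y \near x, forall t, `|t| <= L ->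
     `|f y t - f x t| <= e) ->
  continuous (fun p => f p.1 p.2).
Proof.
move=> cf uf [x t]; apply/cvgrPdist_le => e e0 /=.
have e2 : 0 < e / 2 by rewrite divr_gt0.
have [U' U'x HU] : exists2 U, nbhs x U & forall y, U y -> forall s,
    `|s| <= `|t| + 1 -> `|f y s - f x s| <= e / 2.
  by exists [set y | forall s, `|s| <= `|t| + 1 -> `|f y s - f x s| <= e / 2];
    [exact: uf|].
have [W Wt HW] : exists2 W, nbhs t W & forall s, W s ->
    `|s| <= `|t| + 1 /\ `|f x t - f x s| <= e / 2.
  have h1 : \forall s \near t, `|f x t - f x s| <= e / 2.
    by move/cvgrPdist_le: (cf x t); apply.
  have h2 : \forall s \near t, `|t - s| <= 1.
    by move/cvgrPdist_le: (@cvg_id _ (nbhs t)); apply.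
  eexists; first exact: (filterI h1 h2).
  move=> s [] hs ts; split => //.
  have := ler_normD (s - t) t; rewrite subrK (distrC s); move: ts => /=; lra.
exists (U', W) => //= -[y s] /= [/HU yU /HW[sL xs]].
rewrite -(subrKA (f x s)) (le_trans (ler_normD _ _))// [leRHS]splitr lerD//.
by rewrite distrC yU.
Qed.

(** [X x] is given separately for each [x], so regularity in [x] has to come from the equation: X_y
    - X_x = X_x (Y_x X_y - 1) is small by [propagator_dist], and Y_y - Y_x = Y_y (X_x - X_y) Y_x
    then follows. The bound [K], common to all [x], keeps the constants independent of y. *)
Lemma propagator_continuous n (B : R * R -> 'M[R]_n) (X Y : R -> R -> 'M[R]_n)
    (K : R -> R) :
  continuous B -> (forall x, propagator (fun t => B (x, t)) (X x) (Y x)) ->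
  (forall x t L, `|t| <= L -> `|X x t| <= K L /\ `|Y x t| <= K L) ->
  continuous (fun p => X p.1 p.2) /\ continuous (fun p => Y p.1 p.2).
Proof.
move=> cB XYp XYK.
have Xu x L e : 0 < e -> \forall y \near x, forall t, `|t| <= L ->
    `|X y t - X x t| <= e.
  move=> e0; have [L0|L0] := ltP L 0.
    near=> y; move=> t tL; have := normr_ge0 t.
    by rewrite leNgt (le_lt_trans tL).
  have K0 : 0 <= K L.
    have [|XK _] := XYK x 0 L; first by rewrite normr0.
    exact: le_trans XK.
  (* The factor of the small parameter in the final estimate; dividing [e] by 1 + c also covers c =
     0. *)
  pose c := n%:R * (K L * (n%:R * (n%:R * (K L * K L)) * L)).
  have c0 : 0 <= c by rewrite !mulr_ge0.
  have e'0 : 0 < e / (1 + c) by rewrite divr_gt0// ltr_wpDr.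
  have cL : compact `[- L, L] by exact: segment_compact.
  have Bu := near_uniform cL (fun t _ => cB (x, t)) e'0.
  near=> y; move=> t tL.
  have tube s : `|s| <= L -> `|B (x, s) - B (y, s)| <= e / (1 + c).
    move=> sL; have {sL} : s \in `[- L, L] by rewrite in_itv/= -ler_norml.
    by rewrite distrC; move: s; near: y.
  have XE : X y t - X x t = X x t *m (Y x t *m X y t - 1%:M).
    by have [_ _ XY _ _] := XYp x; rewrite mulmxBr mulmxA XY mul1mx mulmx1.
  have D := propagator_dist (XYp x) (XYp y) _ tube tL.
  rewrite XE (le_trans (mx_norm_mul _ _))//.
  apply: (@le_trans _ _ (c * (e / (1 + c)))).
    set e' := e / _; have -> : c * e' =
        n%:R * (K L * (n%:R * (n%:R * (K L * e') * K L) * L)).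
      by rewrite /c; ring.
    rewrite ler_wpM2l// ler_pM//; first by have [] := XYK x t L tL.
    by apply: D => s sL; have [] := XYK x s L sL; have [] := XYK y s L sL.
  rewrite mulrA ler_pdivrMr ?ltr_wpDr//; lra.
have Yu x L e : 0 < e -> \forall y \near x, forall t, `|t| <= L ->
    `|Y y t - Y x t| <= e.
  move=> e0; have [L0|L0] := ltP L 0.
    near=> y; move=> t tL; have := normr_ge0 t.
    by rewrite leNgt (le_lt_trans tL).
  have K0 : 0 <= K L.
    have [|XK _] := XYK x 0 L; first by rewrite normr0.
    exact: le_trans XK.
  pose c := n%:R * (n%:R * (K L * K L)).
  have c0 : 0 <= c by rewrite !mulr_ge0.
  have e'0 : 0 < e / (1 + c) by rewrite divr_gt0// ltr_wpDr.
  near=> y; move=> t tL.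
  have XE : Y y t - Y x t = Y y t *m (X x t - X y t) *m Y x t.
    have [_ _ XY _ _] := XYp x; have [_ _ /(_ t)/mulmx1C YX _ _] := XYp y.
    by rewrite mulmxBr mulmxBl -!mulmxA XY mulmx1 mulmxA YX mul1mx.
  have XX : `|X y t - X x t| <= e / (1 + c).
    by move: t tL {XE}; near: y; exact: Xu.
  have [_ YxK] := XYK x t L tL; have [_ YyK] := XYK y t L tL.
  rewrite XE (le_trans (mx_norm_mul _ _))//.
  apply: (@le_trans _ _ (c * (e / (1 + c)))).
    set e' := e / _; have -> : c * e' = n%:R * (n%:R * (K L * e') * K L).
      by rewrite /c; ring.
    rewrite ler_wpM2l// ler_pM// (le_trans (mx_norm_mul _ _))//.
    by rewrite ler_wpM2l// ler_pM// distrC.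
  rewrite mulrA ler_pdivrMr ?ltr_wpDr//; lra.
split; apply: continuous_near_uniform => // x t; have [_ _ _ Xd Yd] := XYp x.
- exact: is_derive_continuous (Xd t).
- exact: is_derive_continuous (Yd t).
Unshelve. all: by end_near. Qed.

End propagators.

(** * Parallel transport along concatenated paths *)

(** An epsilon form of continuity that is easy to translate in the parameter and to glue at a
    corner. *)
Lemma within_itvccP (R : realType) (V : normedModType R) (f : R -> V) a b :
  {within `[a, b], continuous f} <->
  (forall t, a <= t <= b -> forall e, 0 < e ->
     \forall s \near t, a <= s <= b -> `|f t - f s| <= e).
Proof.
rewrite subspace_continuousP; split=> cf t tab.
  by move=> e e0; move/cvgrPdist_le: (cf t tab) => /(_ e e0); rewrite near_withinE.
apply/cvgrPdist_le => e e0; rewrite near_withinE.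
by apply: filterS (cf t tab e e0) => s; apply.
Qed.

Lemma near_shiftr (R : realType) (P : set R) (t c : R) :
  (\forall s \near t + c, P s) <-> (\forall s \near t, P (s + c)).
Proof.
rewrite (near_shift t); split; apply: filterS => s /=; rewrite /shift/=;
by rewrite [t + c - t]addrC addKr.
Qed.

Lemma is_derive_scalel (R : realType) (V : normedModType R) (w : V) (t : R) :
  is_derive t 1 (fun s : R => s *: w) w.
Proof.
have d : differentiable (fun s : R => s *: w) t by have [] := is_diff_scalel t w.
apply: DeriveDef; first exact: diff_derivable.
by rewrite deriveE// diff_val scale1r.
Qed.

Section transport.
Context {R : realType} (n : nat) (A0 A1 : R * R -> 'M[R]_n).
Implicit Types (gamma : R -> R * R) (u : R -> 'cV[R]_n).

(** Two transport matrices agree on each vector, because some parallel field starts at it; so the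
    choice made by [PT] is the known matrix. *)
Lemma is_parallel_transport_PT gamma l P :
  is_parallel_transport A0 A1 gamma l P -> PT A0 A1 gamma l = P.
Proof.
move=> HP; have := @getI _ [set Q | is_parallel_transport A0 A1 gamma l Q] P HP.
rewrite -/(PT A0 A1 gamma l); move: (PT _ _ _ _) => Q HQ.
suff QP (v : 'cV_n) : Q *m v = P *m v.
  apply/matrixP => i j; have := QP (delta_mx j 0).
  by rewrite -!colE => /colP/(_ i); rewrite !mxE.
by have [u upar <-] := HP.1 v; rewrite -HQ.2// -HP.2.
Qed.

Definition parallel_at gamma u (t : R) : Prop :=
  [/\ derivable gamma t 1, derivable u t 1 &
      derive1 u t + one_form A0 A1 (gamma t) (derive1 gamma t) *m u t = 0].

Lemma near_eq_parallel_at gamma gamma' u u' (t : R) :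
  {near t, gamma =1 gamma'} -> {near t, u =1 u'} ->
  parallel_at gamma u t -> parallel_at gamma' u' t.
Proof.
move=> gg uu [dg du E]; split; [exact: near_eq_derivable gg dg|
  exact: near_eq_derivable uu du|].
move: E; rewrite !derive1E (@near_eq_derive _ _ _ gamma gamma' t 1 gg)
  (@near_eq_derive _ _ _ u u' t 1 uu).
by rewrite (nbhs_singleton gg) (nbhs_singleton uu).
Qed.

Lemma parallel_at_shift gamma u (c t : R) :
  parallel_at gamma u (t + c) <->
  parallel_at (fun s => gamma (s + c)) (fun s => u (s + c)) t.
Proof.
have shift (V : normedModType R) (f : R -> V) a s : derivable f (s + a) 1 ->
    is_derive s 1 (fun r => f (r + a)) ('D_1 f (s + a)).
  move=> /derivableP fd; have := @is_derive_affine R V f 1 a s ('D_1 f (s + a)).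
  rewrite mul1r scale1r => /(_ fd).
  by under eq_fun do rewrite mul1r.
split=> [[dg du E]|[dg du E]].
  have [dg' gE] := shift _ _ _ _ dg; have [du' uE] := shift _ _ _ _ du.
  split; [exact: dg'|exact: du'|by move: E; rewrite !derive1E gE uE].
have dg1 : is_derive (t + c) 1 gamma ('D_1 (fun s => gamma (s + c)) t).
  have := shift _ (fun s => gamma (s + c)) (- c) (t + c).
  rewrite addrK => /(_ dg).
  by under eq_fun do rewrite subrK.
have du1 : is_derive (t + c) 1 u ('D_1 (fun s => u (s + c)) t).
  have := shift _ (fun s => u (s + c)) (- c) (t + c).
  rewrite addrK => /(_ du).
  by under eq_fun do rewrite subrK.
case: dg1 => dg1 gE; case: du1 => du1 uE.
split; [exact: dg1|exact: du1|by move: E; rewrite !derive1E gE uE].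
Qed.

Lemma eq_parallel_along gamma gamma' u u' l :
  (forall t, 0 < t < l -> gamma t = gamma' t) ->
  (forall t, 0 <= t <= l -> u t = u' t) ->
  parallel_along A0 A1 gamma l u -> parallel_along A0 A1 gamma' l u'.
Proof.
move=> gg uu [cu [S HS]]; split.
  apply: subspace_eq_continuous cu => t; rewrite inE/= in_itv/=; exact: uu.
exists S => t tl tS.
apply: (@near_eq_parallel_at gamma gamma' u u'); last exact: HS.
- near=> s; apply: gg; near: s; exact: near_in_itvoo.
- near=> s; apply: uu; near: s.
  by apply: filterS (near_in_itvoo tl) => s /andP[/ltW -> /ltW].
Unshelve. all: by end_near. Qed.

Lemma parallel_along_cat gamma u l1 l2 : 0 <= l1 -> 0 <= l2 ->
  parallel_along A0 A1 gamma (l1 + l2) u <->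
  parallel_along A0 A1 gamma l1 u /\
  parallel_along A0 A1 (fun t => gamma (t + l1)) l2 (fun t => u (t + l1)).
Proof.
move=> l10 l20; split.
  move=> [/within_itvccP cu [S HS]]; split; split.
  - apply/within_itvccP => t /andP[t0 tl] e e0.
    have := cu t; rewrite t0 (le_trans tl) ?lerDl// => /(_ isT e e0).
    by apply: filterS => s + /andP[s0 sl]; rewrite s0 (le_trans sl) ?lerDl//; exact.
  - exists S => t /andP[t0 tl]; apply: HS.
    by rewrite t0 (lt_le_trans tl)// lerDl.
  - apply/within_itvccP => t /andP[t0 tl] e e0.
    have : 0 <= t + l1 <= l1 + l2 by rewrite addr_ge0//= addrC lerD2l.
    move=> /cu/(_ e e0)/near_shiftr; apply: filterS => s /= + /andP[s0 sl].
    by rewrite addr_ge0//= addrC lerD2l; apply.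
  - exists [seq x - l1 | x <- S] => t /andP[t0 tl] tS.
    apply/parallel_at_shift; apply: HS.
      by rewrite ltr_wpDr//= addrC ltrD2l.
    apply: contra tS => tS; apply/mapP; exists (t + l1) => //.
    by rewrite addrK.
move=> [[/within_itvccP cu1 [S1 HS1]] [/within_itvccP cu2 [S2 HS2]]]; split.
  apply/within_itvccP => t /andP[t0 tl] e e0.
  have h1 : t <= l1 -> \forall s \near t, 0 <= s <= l1 -> `|u t - u s| <= e.
    by move=> tl1; apply: cu1 => //; rewrite t0.
  have h2 : l1 <= t ->
      \forall s \near t, l1 <= s <= l1 + l2 -> `|u t - u s| <= e.
    move=> tl1; have := cu2 (t - l1); rewrite subr_ge0 tl1 lerBlDl => /(_ tl e e0).
    rewrite subrK => H; have -> : t = (t - l1) + l1 by rewrite subrK.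
    apply/near_shiftr; apply: filterS H => s /= + /andP[s1 s2].
    rewrite subrK; apply; move: s1 s2.
    by rewrite lerDr [l1 + _]addrC lerD2r => -> ->.
  have [tl1|tl1|tl1] := ltgtP t l1.
  - near=> s; move=> /andP[s0 sl].
    have sl1 : s <= l1 by apply: ltW; near: s; exact: lt_nbhsl.
    by have := near (h1 (ltW tl1)) s; rewrite s0 sl1; apply.
  - near=> s; move=> /andP[s0 sl].
    have sl1 : l1 <= s by apply: ltW; near: s; exact: lt_nbhsr.
    by have := near (h2 (ltW tl1)) s; rewrite sl sl1; apply.
  - have tl1' : t <= l1 by rewrite tl1.
    have tl1'' : l1 <= t by rewrite tl1.
    near=> s; move=> /andP[s0 sl].
    have [sl1|/ltW sl1] := leP s l1.
      by have := near (h1 tl1') s; rewrite s0 sl1; apply.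
    by have := near (h2 tl1'') s; rewrite sl sl1; apply.
(* The corner [l1] becomes exceptional, and the exceptional parameters of the second piece are
   translated by [l1]. *)
exists (l1 :: S1 ++ [seq x + l1 | x <- S2]) => t /andP[t0 tl].
rewrite inE mem_cat !negb_or => /and3P[tl1 tS1 tS2].
have [tlt|tgt|/eqP] := ltgtP t l1; last by rewrite (negbTE tl1).
  by apply: HS1 => //; rewrite t0.
rewrite -/(parallel_at gamma u t) -(subrK l1 t); apply/parallel_at_shift.
apply: HS2; first by rewrite subr_gt0 tgt ltrBlDl.
by apply: contra tS2 => tS2; apply/mapP; exists (t - l1) => //; rewrite subrK.
Unshelve. all: by end_near. Qed.

Lemma is_parallel_transport_cat gamma l1 l2 P Q : 0 <= l1 -> 0 <= l2 ->
  is_parallel_transport A0 A1 gamma l1 P ->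
  is_parallel_transport A0 A1 (fun t => gamma (t + l1)) l2 Q ->
  is_parallel_transport A0 A1 gamma (l1 + l2) (Q *m P).
Proof.
move=> l10 l20 [Pex PE] [Qex QE]; split=> [v|u].
  have [u1 u1p u10] := Pex v; have [u2 u2p u20] := Qex (u1 l1).
  (* The second field starts at [u1 l1], so the two branches agree at the corner. *)
  exists (fun t => if t <= l1 then u1 t else u2 (t - l1)); last by rewrite l10.
  apply/parallel_along_cat => //; split.
    by apply: eq_parallel_along u1p => // t /andP[_ ->].
  apply: eq_parallel_along u2p => // t /andP[t0 _].
  case: ifPn => [|_]; last by rewrite addrK.
  rewrite gerDr => tle; have -> : t = 0 by apply/eqP; rewrite eq_le tle.
  by rewrite add0r.
move=> /(parallel_along_cat _ _ l10 l20)[/PE u1 /QE].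
by rewrite add0r u1 addrC mulmxA.
Qed.

Lemma eq_is_parallel_transport gamma gamma' l P :
  (forall t, 0 < t < l -> gamma t = gamma' t) ->
  is_parallel_transport A0 A1 gamma l P ->
  is_parallel_transport A0 A1 gamma' l P.
Proof.
move=> gg [Pex PE]; split=> [v|u].
  have [u up u0] := Pex v; by exists u; [exact: eq_parallel_along up|exact: u0].
move=> up; apply: PE; apply: eq_parallel_along up => // t tl.
by rewrite gg.
Qed.

Lemma is_derive_segment (p w : R * R) (t : R) :
  is_derive t 1 (fun s => p + s *: w) w.
Proof.
have h1 : is_derive t 1 (cst p : R -> R * R) 0 by exact: is_derive_cst.
by have := is_deriveD h1 (is_derive_scalel w t); rewrite add0r.
Qed.

(** The segment is run through as t -> c t + d on the line carrying [B]; [c] may be negative for a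
    reversed segment and zero for a degenerate one. The fields X(c t + d) Y(d) v give existence; Y(c
    t + d) u(t), whose derivative vanishes off [S], gives uniqueness. *)
Lemma is_parallel_transport_segment (p q : R * R) (B X Y : R -> 'M[R]_n) c d :
  propagator B X Y ->
  (forall t, 0 < t < 1 ->
     c *: B (c * t + d) = one_form A0 A1 (p + t *: (q - p)) (q - p)) ->
  is_parallel_transport A0 A1 (fun t => p + t *: (q - p)) 1
    (X (c + d) *m Y d).
Proof.
move=> [X0 Y0 XY Xd Yd] BA; split=> [v|u [cu [S HS]]].
  pose w := Y d *m v; exists (fun t => X (c * t + d) *m w); last first.
    by rewrite mulr0 add0r mulmxA XY mul1mx.
  have ud (t : R) : is_derive t 1 (fun t => X (c * t + d) *m w)
      (- (c *: B (c * t + d) *m (X (c * t + d) *m w))).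
    have h1 := is_derive_affine (Xd (c * t + d)).
    have := is_derive_mulmx h1 (is_derive_cst w t 1).
    by rewrite mulmx0 addr0 scalerN mulNmx -!scalemxAl -mulmxA.
  split; first exact: is_derive_within_continuous ud.
  exists [::] => t t01 _; split.
  - by case: (is_derive_segment p (q - p) t).
  - by case: (ud t).
  - rewrite !derive1E; have [_ ->] := ud t; rewrite BA//.
    by have [_ ->] := is_derive_segment p (q - p) t; rewrite addNr.
have cY : {within `[0, 1], continuous (fun t => Y (c * t + d))}.
  exact: is_derive_within_continuous (fun t => is_derive_affine (Yd (c * t + d))).
have : Y (c * 1 + d) *m u 1 = Y (c * 0 + d) *m u 0.
  apply: (@derive0_cst _ _ _ (fun t => Y (c * t + d) *m u t) S) => //.
    by move=> x; apply: cvg_mulmx; [exact: cY|exact: cu].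
  move=> t t01 tS; have [_ /derivableP ud +] := HS t t01 tS.
  rewrite !derive1E; have [_ ->] := is_derive_segment p (q - p) t.
  move=> /eqP; rewrite addr_eq0 -BA// => /eqP uE; rewrite uE in ud.
  have := is_derive_mulmx (is_derive_affine (Yd (c * t + d))) ud.
  by rewrite mulmxN -!scalemxAl -scalemxAr mulmxA subrr.
rewrite mulr1 mulr0 add0r => E.
by rewrite -mulmxA -E mulmxA XY mul1mx.
Qed.

Lemma is_parallel_transport_nil p :
  is_parallel_transport A0 A1 (polyline p [::]) 0 1%:M.
Proof.
split=> [v|u _]; last by rewrite mul1mx.
exists (fun=> v) => //; split; first by move=> t; exact: cvg_cst.
by exists [::] => t /andP[t0 /(lt_trans t0)]; rewrite ltxx.
Qed.

Lemma is_parallel_transport_cons p q s P Q :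
  is_parallel_transport A0 A1 (fun t => p + t *: (q - p)) 1 P ->
  is_parallel_transport A0 A1 (polyline q s) (size s)%:R Q ->
  is_parallel_transport A0 A1 (polyline p (q :: s)) (size (q :: s))%:R (Q *m P).
Proof.
move=> HP HQ; rewrite [size _]/= -add1n natrD.
apply: is_parallel_transport_cat; [exact: ler01|exact: ler0n| |].
  by apply: eq_is_parallel_transport HP => t /andP[_ /ltW t1] /=; rewrite t1.
apply: eq_is_parallel_transport HQ => t /andP[t0 _].
by rewrite /= gerDr leNgt t0 addrK.
Qed.

End transport.

(** * Dependence of propagators on a parameter *)

Section parameter.
Context {R : realType}.

Lemma is_derive_dist (V : normedModType R) (f : R -> V) (x0 : R) D :
  (forall e, 0 < e ->
     \forall x \near x0, `|f x - f x0 - (x - x0) *: D| <= e * `|x - x0|) ->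
  is_derive x0 1 f D.
Proof.
move=> fD.
have cvgD : h^-1 *: ((f \o shift x0) (h *: (1 : R)) - f x0) @[h --> 0^'] --> D.
  apply/cvgrPdist_le => e e0.
  have H : \forall h \near 0, `|f (h + x0) - f x0 - h *: D| <= e * `|h|.
    have /near_shiftr : \forall x \near 0 + x0,
        `|f x - f x0 - (x - x0) *: D| <= e * `|x - x0|.
      by rewrite add0r; exact: fD.
    by apply: filterS => h; rewrite addrK.
  near=> h.
  have h0 : h != 0 by near: h; exact: nbhs_dnbhs_neq.
  have : `|f (h + x0) - f x0 - h *: D| <= e * `|h|.
    by near: h; exact: nbhs_dnbhs.
  rewrite /= [h *: 1]mulr1 mulrC -ler_pdivrMl ?normr_gt0// => He.
  have -> : D - h^-1 *: (f (h + x0) - f x0) =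
      - (h^-1 *: (f (h + x0) - f x0 - h *: D)).
    by rewrite [in RHS]scalerBr scalerA mulVf// scale1r opprB.
  by rewrite normrN normrZ normfV.
have dD : derivable f x0 1 by apply/cvg_ex; exists D.
by apply: DeriveDef => //; exact: cvg_lim.
Unshelve. all: by end_near. Qed.

(** The primitive [E] of the Duhamel source term is an argument and not an integral, because the
    application exhibits one that contains the curvature. *)
Lemma propagator_is_derive n (B : R * R -> 'M[R]_n) (X Y : R -> R -> 'M[R]_n)
    (x0 b : R) (dB E : R -> 'M[R]_n) (K M : R) :
  0 <= b ->
  (forall x, propagator (fun t => B (x, t)) (X x) (Y x)) ->
  continuous (fun p => X p.1 p.2) ->
  (forall x t, 0 <= t <= b -> `|X x t| <= K /\ `|Y x t| <= K) ->
  (forall t, 0 <= t <= b -> `|dB t| <= M) ->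
  (forall e, 0 < e -> \forall x \near x0, forall t, 0 <= t <= b ->
     `|B (x, t) - B (x0, t) - (x - x0) *: dB t| <= e * `|x - x0|) ->
  E 0 = 0 -> {within `[0, b], continuous E} ->
  (forall t, 0 < t < b -> is_derive t 1 E (Y x0 t *m dB t *m X x0 t)) ->
  is_derive x0 1 (fun x => X x b) (- (X x0 b *m E b)).
Proof.
move=> b0 XYp cX XYK dBM Bd E0 cE Ed.
have [_ Y0 XY _ Yd] := XYp x0.
have K0 : 0 <= K.
  by have [|XK _] := XYK x0 0; [rewrite lexx|exact: le_trans XK].
have M0 : 0 <= M by rewrite (le_trans _ (dBM 0 _))// lexx.
pose c := n%:R * (K * (n%:R * (n%:R * (K * K)) + n%:R * (n%:R * (K * M))) * b).
have c0 : 0 <= c by rewrite !(mulr_ge0, addr_ge0).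
apply: is_derive_dist => e e0.
have c1 : 0 < 1 + c by rewrite ltr_wpDr.
pose e' := e / (1 + c).
have e'0 : 0 < e' by rewrite divr_gt0.
have Xu := near_uniform (segment_compact (a := 0) (b := b))
  (fun t _ => cX (x0, t)) e'0.
near=> x.
have [_ _ _ Xd _] := XYp x; have [X00 _ _ _ _] := XYp x.
have XX t : 0 <= t <= b -> `|X x t - X x0 t| <= e'.
  by move: t; near: x; exact: Xu.
have BB t : 0 <= t <= b ->
    `|B (x, t) - B (x0, t) - (x - x0) *: dB t| <= e' * `|x - x0|.
  by move: t; near: x; exact: Bd.
(* Up to sign, the derivative of [D] is the sum of Y (B_x - B_x0 - (x - x0) dB) X_x and (x - x0) Y
   dB (X_x - X_x0), both of order e' |x - x0|. Multiplied by X_x0(b), the increment of [D] is the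
   remainder of the first-order expansion. *)
pose D t := Y x0 t *m X x t + (x - x0) *: E t.
pose c' := n%:R * (n%:R * (K * K)) + n%:R * (n%:R * (K * M)).
have Db : `|D b - D 0| <= c' * e' * `|x - x0| * b.
  have Dd (t : R) : 0 < t < b -> is_derive t 1 D
      (- (Y x0 t *m (B (x, t) - B (x0, t) - (x - x0) *: dB t) *m X x t)
       - (x - x0) *: (Y x0 t *m dB t *m (X x t - X x0 t))).
    move=> tb; apply: is_derive_eq (is_deriveD (is_derive_mulmx (Yd t) (Xd t))
      (is_deriveZ (x - x0) (Ed t tb))) _.
    rewrite !mulmxBr !mulmxBl scalerBr -scalemxAr -scalemxAl mulmxN !mulmxA.
    by rewrite !opprB [RHS]addrC addrA subrK addrC.
  have cD : {within `[0, b], continuous D}.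
    move=> t; apply: cvgD; last by apply: cvgZr; exact: cE.
    apply: cvg_mulmx; last exact: (is_derive_within_continuous Xd).
    exact: (is_derive_within_continuous Yd).
  pose l := c' * e' * `|x - x0|.
  have := ler_dist_derive b0 cD
    (is_derive_within_continuous (is_derive_mull l)) Dd
    (fun t _ => is_derive_mull l t).
  rewrite mulr0 subr0; apply => t tb.
  have tb' : 0 <= t <= b by case/andP: tb => /ltW -> /ltW ->.
  have [_ YK] := XYK x0 t tb'; have [XK _] := XYK x t tb'.
  have -> : l = n%:R * (n%:R * (K * (e' * `|x - x0|)) * K) +
      `|x - x0| * (n%:R * (n%:R * (K * M) * e')) by rewrite /l /c'; ring.
  apply: le_trans (ler_normB _ _) _; rewrite normrN normrZ lerD//.
    apply: le_trans (mx_norm_mul _ _) _; rewrite ler_wpM2l// ler_pM//.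
    by apply: le_trans (mx_norm_mul _ _) _; rewrite ler_wpM2l// ler_pM// BB.
  rewrite ler_wpM2l//.
  apply: le_trans (mx_norm_mul _ _) _; rewrite ler_wpM2l// ler_pM// ?XX//.
  apply: le_trans (mx_norm_mul _ _) _; rewrite ler_wpM2l// ler_pM//.
  exact: dBM.
have -> : X x b - X x0 b - (x - x0) *: - (X x0 b *m E b) =
    X x0 b *m (D b - D 0).
  rewrite /D X00 Y0 E0 mulmx1 scaler0 addr0 mulmxBr mulmxDr mulmxA XY mul1mx mulmx1.
  by rewrite scalerN opprK -scalemxAr addrAC.
apply: le_trans (mx_norm_mul _ _) _.
apply: (@le_trans _ _ (n%:R * (K * (c' * e' * `|x - x0| * b)))).
  rewrite ler_wpM2l// ler_pM//.
  by have [] := XYK x0 b; rewrite ?b0 ?lexx.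
have -> : n%:R * (K * (c' * e' * `|x - x0| * b)) = (c * e') * `|x - x0|.
  by rewrite /c' /c; ring.
rewrite ler_wpM2r// /e' mulrA ler_pdivrMr//; lra.
Unshelve. all: by end_near. Qed.

Lemma primitive_param_continuous m n (g : R * R -> 'M[R]_(m, n))
    (G : R -> R -> 'M[R]_(m, n)) b :
  0 <= b -> continuous g -> (forall x, G x 0 = 0) ->
  (forall x (t : R), is_derive t 1 (G x) (g (x, t))) ->
  continuous (fun x => G x b).
Proof.
move=> b0 cg G0 Gd x; apply/cvgrPdist_le => e e0.
have e'0 : 0 < e / (1 + b) by rewrite divr_gt0// ltr_wpDr.
have gu := near_uniform (segment_compact (a := 0) (b := b))
  (fun t _ => cg (x, t)) e'0.
near=> y.
have gg t : 0 <= t <= b -> `|g (y, t) - g (x, t)| <= e / (1 + b).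
  by move: t; near: y; exact: gu.
have Dd (t : R) : is_derive t 1 (fun t => G x t - G y t) (g (x, t) - g (y, t)).
  exact: is_deriveB.
set l := e / (1 + b) in gg.
have := ler_dist_derive b0 (is_derive_within_continuous Dd)
  (is_derive_within_continuous (is_derive_mull l)) (fun t _ => Dd t)
  (fun t _ => is_derive_mull l t).
rewrite !G0 subrr subr0 mulr0 subr0 => /(_ _)/le_trans; apply.
  by move=> t /andP[/ltW t0 /ltW tb]; rewrite distrC gg// t0.
rewrite /l mulrAC ler_pdivrMr ?ltr_wpDr//; lra.
Unshelve. all: by end_near. Qed.

Lemma is_derive_pd0 (V : normedModType R) (f : R * R -> V) x :
  derivable f x (dir0 R) -> is_derive x.1 1 (fun r => f (r, x.2)) (pd0 f x).
Proof.
move=> df.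
have E : (fun h : R => h^-1 *: ((f \o shift x) (h *: dir0 R) - f x)) =
    fun h : R => h^-1 *:
      (((fun r => f (r, x.2)) \o shift x.1) (h *: (1 : R)) - f (x.1, x.2)).
  apply/funext => h /=; rewrite /shift/=; congr (_ *: (f _ - f _)).
    by rewrite /dir0; congr pair => /=; rewrite [h *: 0]mulr0 add0r.
  by rewrite -surjective_pairing.
split; first by move: df; rewrite /derivable E.
by rewrite /pd0 /derive E.
Qed.

Lemma is_derive_pd1 (V : normedModType R) (f : R * R -> V) x :
  derivable f x (dir1 R) -> is_derive x.2 1 (fun r => f (x.1, r)) (pd1 f x).
Proof.
move=> df.
have E : (fun h : R => h^-1 *: ((f \o shift x) (h *: dir1 R) - f x)) =
    fun h : R => h^-1 *:
      (((fun r => f (x.1, r)) \o shift x.2) (h *: (1 : R)) - f (x.1, x.2)).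
  apply/funext => h /=; rewrite /shift/=; congr (_ *: (f _ - f _)).
    by rewrite /dir1; congr pair => /=; rewrite [h *: 0]mulr0 add0r.
  by rewrite -surjective_pairing.
split; first by move: df; rewrite /derivable E.
by rewrite /pd1 /derive E.
Qed.

End parameter.

(** * Projection onto the rectangle and uniform first-order expansion *)

Section clamp.
Context {R : realType}.

Definition clamp (c t : R) : R := Num.max 0 (Num.min c t).

Lemma clamp_itv c t : 0 <= c -> 0 <= clamp c t <= c.
Proof. by move=> c0; rewrite /clamp le_max lexx ge_max c0 ge_min lexx. Qed.

Lemma clamp_id c t : 0 <= t <= c -> clamp c t = t.
Proof. by move=> /andP[t0 tc]; rewrite /clamp min_r// max_r. Qed.

Lemma continuous_clamp c : continuous (clamp c).
Proof.
move=> t; apply: continuous_max; first exact: cvg_cst.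
by apply: continuous_min; [exact: cvg_cst|exact: cvg_id].
Qed.

Definition clamp2 (a b : R) (x : R * R) : R * R := (clamp a x.1, clamp b x.2).

Lemma clamp2_rectangle a b x : 0 <= a -> 0 <= b -> rectangle a b (clamp2 a b x).
Proof. by move=> a0 b0; split; exact: clamp_itv. Qed.

Lemma clamp2_id a b x : rectangle a b x -> clamp2 a b x = x.
Proof. by case: x => x t [/= xa tb]; rewrite /clamp2 !clamp_id. Qed.

Lemma continuous_clamp2 (V : topologicalType) (f : R * R -> V) a b :
  0 <= a -> 0 <= b -> (forall x, rectangle a b x -> {for x, continuous f}) ->
  continuous (f \o clamp2 a b).
Proof.
move=> a0 b0 cf x; apply: continuous_comp; last exact/cf/clamp2_rectangle.
case: x => x y.
have h1 : clamp a p.1 @[p --> (x, y)] --> clamp a x.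
  by apply: (cvg_comp _ _ cvg_fst); exact: continuous_clamp.
have h2 : clamp b p.2 @[p --> (x, y)] --> clamp b y.
  by apply: (cvg_comp _ _ cvg_snd); exact: continuous_clamp.
exact: (cvg_pair h1 h2).
Qed.

Lemma compact_rectangle (a b : R) : compact (rectangle a b).
Proof.
rewrite (_ : rectangle a b = `[0, a] `*` `[0, b]).
  by apply: compact_setX; exact: segment_compact.
by apply/seteqP; split=> -[x y] /=; rewrite /rectangle/= !in_itv.
Qed.

Lemma bounded_rectangle (V : normedModType R) (f : R * R -> V) a b :
  (forall x, rectangle a b x -> {for x, continuous f}) ->
  exists C, forall x, rectangle a b x -> `|f x| <= C.
Proof.
move=> cf.
have : bounded_set (f @` rectangle a b).
  apply/compact_bounded/continuous_compact; last exact: compact_rectangle.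
  by apply: continuous_in_subspaceT => x; rewrite inE; exact: cf.
move=> [M [_ HM]]; exists (M + 1) => x Tx.
by apply: (HM (M + 1)); [rewrite ltrDl|exists x].
Qed.

Definition C1_at (V : normedModType R) (f : R * R -> V) x : Prop :=
  [/\ {for x, continuous f}, derivable f x (dir0 R), derivable f x (dir1 R),
      {for x, continuous (pd0 f)} & {for x, continuous (pd1 f)}].

Lemma smooth_on_C1 (V : normedModType R) (f : R * R -> V) D x :
  smooth_on D f -> D x -> C1_at f x.
Proof.
move=> [U [_ DU /(_ 1%N)/=[cf [df [c0 _] [c1 _]]]]] /DU Ux.
by have [] := df x Ux; split; [exact: cf|..|exact: c0|exact: c1].
Qed.

(** Mean value inequality in the first coordinate for A(r,t) - r pd0 A(x0,t), whose derivative is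
    small uniformly in [t] by [near_uniform]. Since [x0] is interior, the projection is the identity
    at all the points involved. *)
Lemma uniform_pd0 n (A : R * R -> 'M[R]_n) a b x0 e :
  (forall x, rectangle a b x -> C1_at A x) -> 0 < x0 < a -> 0 < e ->
  \forall x \near x0, forall t, 0 <= t <= b ->
    `|A (clamp2 a b (x, t)) - A (clamp2 a b (x0, t)) - (x - x0) *: pd0 A (x0, t)|
      <= e * `|x - x0|.
Proof.
move=> AC1 x0a e0.
have cpd t : `[0, b]%classic t -> {for (x0, t), continuous (pd0 A)}.
  rewrite /= in_itv/= => tb; have [|_ _ _ c0 _] := AC1 (x0, t); last exact: c0.
  by split=> //=; case/andP: x0a => /ltW -> /ltW ->.
have pdu := near_uniform (segment_compact (a := 0) (b := b)) cpd e0.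
have x0ab : \forall x \near x0, 0 < x < a by exact: near_in_itvoo.
have [d /= d0 Hd] := (nbhs_ballP _ _).1 (filterI pdu x0ab).
apply/(nbhs_ballP _ _).2; exists d => //= x; rewrite -ball_normE/= distrC => xd t tb.
pose f r := A (r, t) - r *: pd0 A (x0, t).
have Hd' r : `|r - x0| <= `|x - x0| ->
    `|pd0 A (r, t) - pd0 A (x0, t)| <= e /\ 0 < r < a.
  move=> rx; have [|h1 h2] := Hd r; last by split=> //; apply: h1.
  by rewrite -ball_normE/= distrC; exact: le_lt_trans xd.
have x0x0 : `|x0 - x0| <= `|x - x0| by rewrite subrr normr0.
have rect r : 0 < r < a -> rectangle a b (r, t).
  by case/andP=> /ltW r0 /ltW ra; split=> //=; rewrite r0.
have := @ler_dist_between R _ _ f (fun r => pd0 A (r, t) - pd0 A (x0, t)) e x0 x.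
rewrite !clamp2_id; [|exact: rect|by apply: rect; have [] := Hd' x].
have -> : f x - f x0 = A (x, t) - A (x0, t) - (x - x0) *: pd0 A (x0, t).
  by rewrite /f scalerBl !opprB addrACA [RHS]addrACA; congr (_ + _); rewrite addrC.
apply=> r /Hd'[pdr ra]; last by [].
have [_ dA _ _ _] := AC1 (r, t) (rect r ra).
apply: is_deriveB; [exact: is_derive_pd0 dA|exact: is_derive_scalel].
Qed.

End clamp.

(** * Derivative of the holonomy *)

Section holonomy_derivative.
Context {R : realType} (n : nat) (A0 A1 : R * R -> 'M[R]_n) (a b : R).
Hypothesis a0 : 0 < a.
Hypothesis b0 : 0 < b.
Hypothesis A0_C1 : forall x, rectangle a b x -> C1_at A0 x.
Hypothesis A1_C1 : forall x, rectangle a b x -> C1_at A1 x.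

Let B0 := A0 \o clamp2 a b.
Let B1 := A1 \o clamp2 a b.
Let F := curvature A0 A1 \o clamp2 a b.

Lemma continuous_B0 : continuous B0.
Proof.
by apply: continuous_clamp2 => [||x /A0_C1[]//]; exact: ltW.
Qed.

Lemma continuous_B1 : continuous B1.
Proof.
by apply: continuous_clamp2 => [||x /A1_C1[]//]; exact: ltW.
Qed.

Lemma continuous_F : continuous F.
Proof.
apply: continuous_clamp2 => [||x Tx]; [exact: ltW..|].
have [c0 _ _ _ d0] := A0_C1 Tx; have [c1 _ _ d1 _] := A1_C1 Tx.
apply: cvgD; first by apply: cvgB; [exact: d1|exact: d0].
by apply: cvgB; apply: cvg_mulmx; [exact: c0|exact: c1|exact: c1|exact: c0].
Qed.

(** [P], [T] and [Q x] belong to the bottom side, the top side (S in the overview) and the vertical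
    line through (x,0). A final [i] marks the inverse, and [G x] is the primitive of Q^-1 F Q along
    that line. *)
Variables (P Pi T Ti : R -> 'M[R]_n) (Q Qi G : R -> R -> 'M[R]_n) (K : R).
Hypothesis PP : propagator (fun s => B0 (s, 0)) P Pi.
Hypothesis TT : propagator (fun s => B0 (s, b)) T Ti.
Hypothesis QQ : forall x, propagator (fun t => B1 (x, t)) (Q x) (Qi x).
Hypothesis cQ : continuous (fun p => Q p.1 p.2).
Hypothesis QK : forall x t, 0 <= t <= b -> `|Q x t| <= K /\ `|Qi x t| <= K.
Hypothesis G0 : forall x, G x 0 = 0.
Hypothesis Gd : forall x (t : R),
  is_derive t 1 (G x) (Qi x t *m F (x, t) *m Q x t).

(* Along [t], [Qi *m B0 *m Q] has derivative
   [Qi *m (pd1 A0 + A1 *m A0 - A0 *m A1) *m Q]; adding the curvature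
   leaves [Qi *m pd0 A1 *m Q], the source term of the variation of [Q]. *)
Lemma variation_derivative x t : 0 < x < a -> 0 < t < b ->
  is_derive t 1
    (fun s => G x s + (Qi x s *m B0 (x, s) *m Q x s - B0 (x, 0)))
    (Qi x t *m pd0 A1 (x, clamp b t) *m Q x t).
Proof.
move=> /andP[/ltW x0 /ltW xa] tb.
have rect s : 0 < s < b -> rectangle a b (x, s).
  by move=> /andP[/ltW s0 /ltW sb]; split; rewrite /= ?x0 ?s0.
have [_ _ _ Qd Qid] := QQ x.
have BE s : 0 < s < b -> B0 (x, s) = A0 (x, s).
  by move=> /rect sT; rewrite /B0/= clamp2_id.
have Bd : is_derive t 1 (fun s => B0 (x, s)) (pd1 A0 (x, t)).
  have [_ _ dA _ _] := A0_C1 (rect t tb).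
  (* [B0] inherits the partial derivative because it agrees with [A0] on a vertical interval around
     [t]; this uses the strict bounds on [t]. *)
  apply: near_eq_is_derive (is_derive_pd1 dA).
  near=> s; apply/esym/BE; near: s; exact: near_in_itvoo.
have cd : is_derive t 1 (fun=> B0 (x, 0)) 0 by exact: is_derive_cst.
apply: is_derive_eq (is_deriveD (Gd x t) (is_deriveB
  (is_derive_mulmx (is_derive_mulmx (Qid t) Bd) (Qd t)) cd)) _.
rewrite subr0 /F /B1 BE//= clamp2_id; last exact: rect.
rewrite clamp_id; last by case/andP: tb => /ltW -> /ltW ->.
set A0t := A0 _; set A1t := A1 _; set q := Qi x t; set p := pd1 A0 (x, t).
have -> : (q *m A1t *m A0t + q *m p) *m Q x t +
    q *m A0t *m - (A1t *m Q x t) =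
    q *m (p + (A1t *m A0t - A0t *m A1t)) *m Q x t.
  rewrite mulmxDr mulmxBr !mulmxDl mulNmx mulmxN !mulmxA.
  by rewrite -addrA addrCA.
rewrite -mulmxDl -mulmxDr /curvature addrACA subrK.
by rewrite -[A0 _ *m _ - _]opprB addNr addr0.
Unshelve. all: by end_near. Qed.

(** The boundary part of the variation of [Q] contributes B0(x,b) Q and Q B0(x,0), which cancel the
    derivatives of [Ti] and [P]; only the curvature term [G] survives. *)
Lemma is_derive_holonomy x : 0 < x < a ->
  is_derive x 1 (fun x => Qi 0 b *m Ti x *m Q x b *m P x)
    (- (Qi 0 b *m Ti x *m Q x b *m G x b *m P x)).
Proof.
move=> xa.
pose E t := G x t + (Qi x t *m B0 (x, t) *m Q x t - B0 (x, 0)).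
have [Q0 Qi0 QQi Qd Qid] := QQ x.
have [M pdM] :=
  bounded_rectangle (fun y Ty => let: And5 _ _ _ c _ := A1_C1 Ty in c).
have Qbd : is_derive x 1 (Q^~ b) (- (Q x b *m E b)).
  apply: (propagator_is_derive (ltW b0) QQ cQ QK
    (dB := fun t => pd0 A1 (x, clamp b t)) (M := M)).
  - move=> t tb; apply: pdM; split; last exact/clamp_itv/ltW.
    by case/andP: xa => /ltW /= -> /ltW ->.
  - move=> e e0; have := uniform_pd0 A1_C1 xa e0.
    apply: filterS => y Hy t tb; rewrite clamp_id//; exact: Hy.
  - by rewrite /E G0 Q0 Qi0 mul1mx mulmx1 subrr addr0.
  - move=> t; apply: cvgD.
      exact: (is_derive_within_continuous (Gd x)).
    apply: cvgB; last exact: cvg_cst.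
    apply: cvg_mulmx; last exact: (is_derive_within_continuous Qd).
    apply: cvg_mulmx; first exact: (is_derive_within_continuous Qid).
    have cB s : {for s, continuous (fun s => B0 (x, s))}.
      apply: continuous_comp; last exact: continuous_B0.
      exact: (cvg_pair (cvg_cst x) cvg_id).
    exact: (continuous_subspaceT cB).
  - by move=> t tb; exact: variation_derivative.
have [_ _ _ Pd _] := PP; have [_ _ _ _ Tid] := TT.
apply: is_derive_eq (is_derive_mulmx (is_derive_mulmx (is_derive_mulmx
  (is_derive_cst (Qi 0 b) x 1) (Tid x)) Qbd) (Pd x)) _.
have -> : Q x b *m E b =
    Q x b *m G x b + (B0 (x, b) *m Q x b - Q x b *m B0 (x, 0)).
  by rewrite /E mulmxDr mulmxBr !mulmxA QQi mul1mx.
rewrite mul0mx add0r.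
rewrite !(mulmxDl, mulmxDr, mulmxN, mulmxBr, mulmxBl, mulNmx, mulmxA).
rewrite !(opprD, opprK).
by rewrite addrCA addNKr addrK.
Qed.
End holonomy_derivative.

(** * Integrals over a rectangle *)

Section rectangle_integral.
Context {R : realType}.
Local Notation mu := (@lebesgue_measure R).
Local Notation mR := (measurableTypeR R).

(** Second countability: an open set of the plane is a countable union of squares with rational
    centre and radius, which are measurable for the product sigma-algebra. *)
Lemma open_measurable2 (O : set (R * R)) :
  open O -> measurable (O : set (mR * mR)).
Proof.
move=> oO.
pose box1 (q r : rat) : set mR := ball (ratr q : R) (ratr r).
pose box2 q : set (mR * mR) := box1 q.1.1 q.2 `*` box1 q.1.2 q.2.
have -> : O = \bigcup_(q in [set q | box2 q `<=` O]) box2 q.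
  apply/seteqP; split=> [[x y] Oxy|p [q qO]]; last exact: qO.
  have [e /= e0 He] := (nbhs_ballP _ _).1 (open_nbhs_nbhs (conj oO Oxy)).
  (* With r < e / 2, a square of radius [r] that contains (x,y) lies in the ball of radius [e]
     around it. *)
  have [|r] := @rat_in_itvoo R (e / 4) (e / 2); first lra.
  rewrite in_itv/= => /andP[r1 r2].
  have [|q1] := @rat_in_itvoo R (x - ratr r) (x + ratr r); first lra.
  rewrite in_itv/= => /andP[q11 q12].
  have [|q2] := @rat_in_itvoo R (y - ratr r) (y + ratr r); first lra.
  rewrite in_itv/= => /andP[q21 q22].
  have near_q (q z w : R) : z - ratr r < q -> q < z + ratr r ->
      `|q - w| < ratr r -> `|z - w| < e.
    by move=> h1 h2; rewrite !ltr_norml => /andP[h3 h4]; lra.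
  exists (q1, q2, r); last first.
    by split; rewrite /box1 -ball_normE/= ltr_norml; lra.
  move=> [z w] /=; rewrite /box2/= /box1 -ball_normE/= => -[h1 h2].
  by apply: He; split; rewrite -ball_normE/=; [exact: near_q h1|exact: near_q h2].
rewrite bigcup_mkcond; apply: countable_bigcupT_measurable => [|q].
  exact: countableP.
case: ifPn => // _; apply: measurableX; apply: open_measurable; exact: ball_open.
Qed.

Lemma continuous_measurable_fun2 (f : R * R -> R) : continuous f ->
  measurable_fun setT (f : mR * mR -> mR).
Proof.
move=> /continuousP cf; apply: (measurability _ (RGenOpens.measurableE R)).
move=> _ [_ [a [b ->] <-]]; rewrite setTI; apply: open_measurable2.
exact/cf/interval_open.
Qed.

(** A continuous function is bounded on the rectangle, whose measure is finite, hence integrable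
    there and subject to Fubini. *)
Lemma Rintegral_rectangle (f : R * R -> R) (a b : R) : 0 <= a -> 0 <= b ->
  continuous f ->
  \int[@lebesgue2 R]_(x in rectangle a b) f x =
  \int[mu]_(x in `[0, a]) \int[mu]_(t in `[0, b]) f (x, t).
Proof.
move=> a0 b0 cf.
pose D : set (mR * mR) := `[0, a]%classic `*` `[0, b]%classic.
have DE : rectangle a b = D.
  by rewrite /D; apply/seteqP; split=> -[x y] /=; rewrite !in_itv.
have mD : measurable D by apply: measurableX.
have muE (c : R) : 0 <= c -> mu `[0, c] = c%:E.
  move=> c0; rewrite lebesgue_measure_itv/= lte_fin.
  by case: ltgtP c0 => // [c0|<-] _; rewrite ?sube0.
have lD : @lebesgue2 R D = (a * b)%:E.
  by rewrite EFinM -(muE a)// -(muE b)//; apply: product_measure1E.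
have fi : (@lebesgue2 R).-integrable D (EFin \o f).
  apply: measurable_bounded_integrable => //.
  - suff : (@lebesgue2 R D < +oo)%E by [].
    by rewrite lD ltry.
  - apply: (@measurable_funS _ _ _ _ setT) => //.
    exact: continuous_measurable_fun2.
  - have [C HC] := @bounded_rectangle R R f a b (fun x _ => cf x).
    exists C; split=> [|M CM x Dx]; first exact: num_real.
    apply: le_trans (HC x _) _; last exact: ltW.
    by rewrite DE.
have fxi x : mu.-integrable `[0, b] (EFin \o (fun t => f (x, t))).
  apply: continuous_compact_integrable; first exact: segment_compact.
  apply: continuous_subspaceT => t; apply: continuous_comp; last exact: cf.
  exact: (cvg_pair (cvg_cst x) cvg_id).
rewrite DE /Rintegral integral_mkcond /lebesgue2 -integral12_prod_meas1; last first.
  by rewrite -integrable_mkcond; [exact: fi|exact: mD].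
(* Fubini was applied to the extension by zero: its inner integral vanishes for [x] outside [0,a]
   and otherwise runs over [0,b]. *)
congr fine; rewrite [RHS]integral_mkcond; apply: eq_integral => x _.
rewrite /fubini_F patchE; case: ifPn => [|]; rewrite (inE, notin_setE)/= => xa.
  rewrite fineK; last exact: integrable_fin_num (fxi x).
  rewrite [RHS]integral_mkcond; apply: eq_integral => t _.
  rewrite !patchE; congr (if _ then _ else _).
  by apply/idP/idP; rewrite !inE /D/=; [case|split].
by apply: integral0_eq => t _; rewrite patchE memNset// => -[].
Qed.

End rectangle_integral.

(** Differentiability is asked only inside, and the endpoints are reached by continuity of [F]; this
    lets the holonomy, differentiated on the open interval, be recovered on the closed one. *)
Lemma Rintegral_continuous_FTC2 (R : realType) (f F : R -> R) (c : R) :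
  0 < c -> continuous f -> continuous F ->
  (forall t : R, 0 < t < c -> is_derive t 1 F (f t)) ->
  \int[@lebesgue_measure R]_(t in `[0, c]) f t = F c - F 0.
Proof.
move=> c0 cf cF Fd; rewrite /Rintegral (@continuous_FTC2 _ f F)//.
- exact: continuous_subspaceT.
- split=> [t||]; first by rewrite in_itv/= => /Fd[].
    by apply: cvg_at_right_filter; exact: cF.
  by apply: cvg_at_left_filter; exact: cF.
- by move=> t; rewrite in_itv/= => /Fd[_ <-]; rewrite derive1E.
Qed.

(** * Transport along horizontal and vertical segments of the rectangle *)

Section rectangle_transport.
Context {R : realType} (n : nat) (A0 A1 : R * R -> 'M[R]_n) (a b : R).

Lemma segment_itv (u v c t : R) : 0 <= u <= c -> 0 <= v <= c -> 0 < t < 1 ->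
  0 <= (v - u) * t + u <= c.
Proof.
move=> /andP[u0 uc] /andP[v0 vc] /andP[t0 t1].
have -> : (v - u) * t + u = v * t + u * (1 - t) by ring.
have t1' : 0 <= 1 - t by lra.
rewrite addr_ge0 ?mulr_ge0 ?(ltW t0)//=.
have -> : c = c * t + c * (1 - t) by ring.
by rewrite lerD// ler_wpM2r// ltW.
Qed.

(** The case c = v - u, d = u of the segment lemma: the direction has no second component, and the
    projection is the identity because the segment stays in the rectangle. *)
Lemma is_parallel_transport_horizontal u v y (P Pi : R -> 'M[R]_n) :
  0 <= u <= a -> 0 <= v <= a -> 0 <= y <= b ->
  propagator (fun s => (A0 \o clamp2 a b) (s, y)) P Pi ->
  is_parallel_transport A0 A1 (fun t => (u, y) + t *: ((v, y) - (u, y))) 1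
    (P v *m Pi u).
Proof.
move=> ua va yb PP; rewrite -{2}(subrK u v).
apply: (is_parallel_transport_segment (c := v - u) (d := u) PP) => t t01 /=.
rewrite clamp2_id; last by split=> //=; exact: segment_itv.
have -> : (u, y) + t *: ((v, y) - (u, y)) = ((v - u) * t + u, y).
  apply/pair_equal_spec; split=> /=; first by rewrite addrC mulrC.
  by rewrite subrr [t *: _]mulr0 addr0.
by rewrite /one_form/= subrr scale0r addr0.
Qed.

Lemma is_parallel_transport_vertical x u v (Q Qi : R -> 'M[R]_n) :
  0 <= x <= a -> 0 <= u <= b -> 0 <= v <= b ->
  propagator (fun s => (A1 \o clamp2 a b) (x, s)) Q Qi ->
  is_parallel_transport A0 A1 (fun t => (x, u) + t *: ((x, v) - (x, u))) 1
    (Q v *m Qi u).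
Proof.
move=> xa ub vb QQ; rewrite -{2}(subrK u v).
apply: (is_parallel_transport_segment (c := v - u) (d := u) QQ) => t t01 /=.
rewrite clamp2_id; last by split=> //=; exact: segment_itv.
have -> : (x, u) + t *: ((x, v) - (x, u)) = (x, (v - u) * t + u).
  apply/pair_equal_spec; split=> /=; last by rewrite addrC mulrC.
  by rewrite subrr [t *: _]mulr0 addr0.
by rewrite /one_form/= subrr scale0r add0r.
Qed.

End rectangle_transport.

(** * The holonomy formula, by integration over the horizontal coordinate *)

Theorem proposition3p1 (R : realType) (n : nat) (G : set 'M[R]_n)
    (hG : closed_orthogonal_subgroup G) (a b : R) (ha : 0 < a) (hb : 0 < b)
    (A0 A1 : R * R -> 'M[R]_n)
    (A0_smooth : smooth_on (rectangle a b) A0)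
    (A1_smooth : smooth_on (rectangle a b) A1)
    (A_g : forall x, rectangle a b x ->
       lie_algebra G (A0 x) /\ lie_algebra G (A1 x)) :
  Hol_rectangle A0 A1 a b - 1%:M =
  - mx_integral (rectangle a b)
      (fun x => PT_plus A0 A1 b x *m curvature A0 A1 x *m PT_minus A0 A1 x).
Proof.
have A0C x (Tx : rectangle a b x) := smooth_on_C1 A0_smooth Tx.
have A1C x (Tx : rectangle a b x) := smooth_on_C1 A1_smooth Tx.
have a0 := ltW ha; have b0 := ltW hb.
have aa : 0 <= a <= a by apply/andP.
have bb : 0 <= b <= b by apply/andP.
have a00 : 0 <= (0 : R) <= a by apply/andP.
have b00 : 0 <= (0 : R) <= b by apply/andP.
have cB0 := continuous_B0 ha hb A0C.
have cB1 := continuous_B1 ha hb A1C.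
have cF := continuous_F ha hb A0C A1C.
have clampT x := clamp2_rectangle x a0 b0.
have [C0 HC0] :=
  bounded_rectangle (fun x Tx => let: And5 c _ _ _ _ := A0C x Tx in c).
have [C1 HC1] :=
  bounded_rectangle (fun x Tx => let: And5 c _ _ _ _ := A1C x Tx in c).
have c2 (V : topologicalType) (f : R * R -> V) : continuous f ->
    (forall x, continuous (fun t => f (x, t))) /\
    (forall t, continuous (fun x => f (x, t))).
  move=> cf; split=> [x t|t x]; apply: continuous_comp; try exact: cf.
    exact: (cvg_pair (cvg_cst x) cvg_id).
  exact: (cvg_pair cvg_id (cvg_cst t)).
have [P [Pi [PP _]]] :=
  propagator_exists ((c2 _ _ cB0).2 0) (fun x => HC0 _ (clampT (x, 0))).
have [T [Ti [TT _]]] :=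
  propagator_exists ((c2 _ _ cB0).2 b) (fun x => HC0 _ (clampT (x, b))).
(* These choices give no regularity in [x]; it is recovered by [propagator_continuous] from bounds
   common to all [x], since [C1] bounds the projected form on the whole plane. *)
have /choice[Q /choice[Qi QQ']] := fun x =>
  propagator_exists ((c2 _ _ cB1).1 x) (fun t => HC1 _ (clampT (x, t))).
pose K (L : R) := 1 + 2 * expR ((2 * (n%:R * C1) + 1) * L).
have QQ x : propagator (fun t => (A1 \o clamp2 a b) (x, t)) (Q x) (Qi x).
  by have [] := QQ' x.
have QK x t L : `|t| <= L -> `|Q x t| <= K L /\ `|Qi x t| <= K L.
  move=> tL; have [_ /(_ t)/=[h1 h2]] := QQ' x.
  have C10 : 0 <= C1 by rewrite (le_trans _ (HC1 _ (clampT (0, 0)))).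
  have KK : 1 + 2 * expR ((2 * (n%:R * C1) + 1) * `|t|) <= K L.
    by rewrite lerD2l// ler_pM2l// ler_expR ler_wpM2l// addr_ge0// !mulr_ge0.
  by split; [exact: le_trans KK|exact: le_trans KK].
have [cQ cQi] := propagator_continuous cB1 QQ QK.
have QKb x t : 0 <= t <= b -> `|Q x t| <= K b /\ `|Qi x t| <= K b.
  by move=> /andP[t0 tb]; apply: QK; rewrite ger0_norm.
pose F := curvature A0 A1 \o clamp2 a b.
pose g p := Qi p.1 p.2 *m F p *m Q p.1 p.2.
have cg : continuous g.
  move=> p; apply: cvg_mulmx; last exact: cQ.
  by apply: cvg_mulmx; [exact: cQi|exact: cF].
have /choice[H H'] := fun x => primitive_exists ((c2 _ _ cg).1 x).
have H0 x : H x 0 = 0 by have [] := H' x.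
have Hd x (t : R) : is_derive t 1 (H x) (g (x, t)) by have [] := H' x.
have cH := primitive_param_continuous b0 cg H0 Hd.
have [P0 Pi0 _ Pd _] := PP; have [T0 Ti0 _ _ Tid] := TT.
have cP : continuous P by move=> x; exact: is_derive_continuous (Pd x).
have cTi : continuous Ti by move=> x; exact: is_derive_continuous (Tid x).
(* [M x] is the transport from (x,0) up to the top side, back along it and down to the origin, so
   that [Phi x] is the holonomy of the rectangle of width [x]. *)
pose M x := Qi 0 b *m Ti x *m Q x b.
pose Phi x := M x *m P x.
have cM : continuous M.
  move=> x; apply: cvg_mulmx; last exact: (c2 _ _ cQ).2.
  by apply: cvg_mulmx; [exact: cvg_cst|exact: cTi].
have PhiD x : 0 < x < a -> is_derive x 1 Phi (- (M x *m H x b *m P x)).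
  exact: (is_derive_holonomy ha hb A0C A1C PP TT QQ cQ QKb H0 Hd).
have Qi0 x : Qi x 0 = 1%:M by have [] := QQ x.
have Q0 x : Q x 0 = 1%:M by have [] := QQ x.
pose nilT p := is_parallel_transport_nil A0 A1 p.
have PTm x : rectangle a b x -> PT_minus A0 A1 x = Q x.1 x.2 *m P x.1.
  move=> [xa tb].
  have h1 := is_parallel_transport_horizontal A1 a00 xa b00 PP.
  have h2 := is_parallel_transport_vertical A0 xa b00 tb (QQ x.1).
  have := is_parallel_transport_cons h1 (is_parallel_transport_cons h2 (nilT _)).
  by move/is_parallel_transport_PT; rewrite Pi0 Qi0 mul1mx !mulmx1.
have PTp x : rectangle a b x ->
    PT_plus A0 A1 b x = Qi 0 b *m Ti x.1 *m Q x.1 b *m Qi x.1 x.2.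
  move=> [xa tb].
  have h1 := is_parallel_transport_vertical A0 xa tb bb (QQ x.1).
  have h2 := is_parallel_transport_horizontal A1 xa a00 bb TT.
  have h3 := is_parallel_transport_vertical A0 a00 bb b00 (QQ 0).
  have := is_parallel_transport_cons h1 (is_parallel_transport_cons h2
    (is_parallel_transport_cons h3 (nilT _))).
  by move/is_parallel_transport_PT; rewrite T0 Q0 !mul1mx !mulmxA.
have HolE : Hol_rectangle A0 A1 a b = Phi a.
  have h0 := is_parallel_transport_horizontal A1 a00 aa b00 PP.
  have h1 := is_parallel_transport_vertical A0 aa b00 bb (QQ a).
  have h2 := is_parallel_transport_horizontal A1 aa a00 bb TT.
  have h3 := is_parallel_transport_vertical A0 a00 bb b00 (QQ 0).
  have := is_parallel_transport_cons h0 (is_parallel_transport_cons h1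
    (is_parallel_transport_cons h2 (is_parallel_transport_cons h3 (nilT _)))).
  move/is_parallel_transport_PT.
  by rewrite T0 Q0 Pi0 Qi0 !mul1mx !mulmx1.
have Phi0 : Phi 0 = 1%:M.
  have [_ _ QQi _ _] := QQ 0.
  by rewrite /Phi /M Ti0 P0 !mulmx1; exact: mulmx1C.
(* The integrand with projected forms: continuous on the plane, equal to the original on the
   rectangle, and with outer factors that depend on the first coordinate only. *)
pose f p := M p.1 *m g p *m P p.1.
have cf : continuous f.
  move=> p; apply: cvg_mulmx.
    apply: cvg_mulmx; last exact: cg.
    by apply: (cvg_comp _ _ cvg_fst); exact: cM.
  by apply: (cvg_comp _ _ cvg_fst); exact: cP.
have cMHP : continuous (fun x => M x *m H x b *m P x).
  move=> x; apply: cvg_mulmx; last exact: cP.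
  by apply: cvg_mulmx; [exact: cM|exact: cH].
have cPhi : continuous Phi by move=> x; apply: cvg_mulmx; [exact: cM|exact: cP].
have cij (V : topologicalType) (h : V -> 'M[R]_n) i j :
    continuous h -> continuous (fun x => h x i j).
  by move=> ch x; have /cvg_mxP := ch x; exact.
(* With the identity read as [Phi 0], the claim is the fundamental theorem of calculus for each
   entry of [Phi] on [0,a]. *)
apply/matrixP => i j; rewrite HolE -Phi0 [LHS]mxE [X in _ + X = _]mxE [RHS]mxE.
rewrite [X in _ = - X]mxE.
have -> : \int[@lebesgue2 R]_(x in rectangle a b)
    (PT_plus A0 A1 b x *m curvature A0 A1 x *m PT_minus A0 A1 x) i j =
    \int[@lebesgue2 R]_(x in rectangle a b) f x i j.
  apply: eq_Rintegral => x; rewrite inE => Tx.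
  by rewrite PTp// PTm// /f /g /F /= clamp2_id// /M !mulmxA.
rewrite (Rintegral_rectangle a0 b0 (cij _ _ i j cf)).
have inner x : \int[@lebesgue_measure R]_(t in `[0, b]) f (x, t) i j =
    (M x *m H x b *m P x) i j.
  pose HM t := M x *m H x t *m P x.
  have HMd (t : R) : is_derive t 1 HM (f (x, t)).
    apply: is_derive_eq (is_derive_mulmx (is_derive_mulmx
      (is_derive_cst (M x) t 1) (Hd x t)) (is_derive_cst (P x) t 1)) _.
    by rewrite mul0mx add0r mulmx0 addr0.
  have -> : (M x *m H x b *m P x) i j = HM b i j - HM 0 i j.
    by rewrite /HM H0 mulmx0 mul0mx [X in _ - X]mxE subr0.
  apply: (Rintegral_continuous_FTC2 (F := fun t => HM t i j)) => //.
  - exact: (cij _ _ i j ((c2 _ _ cf).1 x)).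
  - by apply: cij => t; exact: is_derive_continuous (HMd t).
  - by move=> t _; have /is_derive_mxP := HMd t; exact.
under eq_Rintegral do rewrite inner.
(* The derivative of [Phi] is minus the inner integral, whence the sign in the statement; the
   primitive used is therefore the opposite of [Phi]. *)
have NPhic : continuous (fun x => - Phi x i j).
  by move=> x; apply: cvgN; exact: (cij _ _ i j cPhi).
have NPhid x : 0 < x < a ->
    is_derive x 1 (fun x => - Phi x i j) ((M x *m H x b *m P x) i j).
  move=> /PhiD /is_derive_mxP/(_ i j); rewrite mxE => d.
  by rewrite -[X in is_derive _ _ _ X]opprK; exact: is_deriveN.
rewrite (Rintegral_continuous_FTC2 ha (cij _ _ i j cMHP) NPhic NPhid).
by rewrite opprK opprD opprK.
Qed.
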